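(* Let a discrete group $\Gamma$ act by isometries on a geodesic $\delta$-hyperbolic metric space $X$ with base point $o$. Let $m>0$ and let $\mathcal A=(A_i)_{i\in I}$ be a family of subsets of $S_m(o)$ satisfying $$\operatorname{dist}(A_i,A_j)\ge4\delta,\qquad i\ne j.$$ Assume that $E_{<2m+2\delta}$ is finite. Then there is a constant $C_4$, depending only on $\kappa_2(2m+2\delta)$, such that $$\|\mathcal H^{\exists}_{\mathcal A,\varepsilon}x\|_4=\|\mathcal H^{\forall,\delta}_{\mathcal A,\varepsilon}x\|_4\le C_4\|x\|_4$$ for every Fourier polynomial $x$ supported in $\bigcup_i\mathcal L^{\exists}_{A_i}$ and every finitely supported $\varepsilon=(\varepsilon_i)_{i\in I}$ with $|\varepsilon_i|\le1$.
   Context: Write $|x|=\operatorname{dist}(o,x)$; $S_m(o)=\{x:|x|=m\}$; $B_r(a)=\{x:\operatorname{dist}(x,a)<r\}$ for $r>0$; the distance between sets is the infimum of distances between their points. $X$ is $\delta$-hyperbolic if every side of every geodesic triangle lies in the open $\delta$-neighborhood of the union of the other two sides (this forces $\delta>0$). $E_{<R}=\{g\in\Gamma:|g.o|<R\}$. For $A\subset X$ and $r>0$, $\mathcal L^{\exists}_A=\{g\in\Gamma:\text{some geodesic from } o \text{ to } g.o \text{ meets } A\}$ and $\mathcal L^{\forall,r}_A=\{g\in\Gamma:\text{there exists } a\in A \text{ such that every geodesic from } o\text{ to } g.o\text{ meets } B_r(a)\}$. $\lambda$ is the left regular representation of $\Gamma$ on $\ell_2(\Gamma)$. For a Fourier polynomial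 (finite sum) $x=\sum_gc_g\lambda_g$, $\tau(x)=c_e$, $\|x\|_p=\tau(|x|^p)^{1/p}$; $L^p(\widehat\Gamma)$ is the completion for this norm; $x$ is supported in $\mathcal E\subset\Gamma$ if $c_g=0$ for $g\notin\mathcal E$. $P_{\mathcal E}$ is the Fourier projection with $P_{\mathcal E}\lambda_g=\lambda_g$ if $g\in\mathcal E$ and $0$ otherwise. $\mathcal H^{\exists}_{\mathcal A,\varepsilon}=\sum_i\varepsilon_iP_{\mathcal L^{\exists}_{A_i}}$, $\mathcal H^{\forall,r}_{\mathcal A,\varepsilon}=\sum_i\varepsilon_iP_{\mathcal L^{\forall,r}_{A_i}}$, and $\kappa_q(R)=\|P_{E_{<R}}:L^1(\widehat\Gamma)\to L^q(\widehat\Gamma)\|$. *)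

(* Defs.v *)
From mathcomp Require Import all_boot all_order all_algebra.
From mathcomp Require Export monoid.
From mathcomp Require Export complex.
From mathcomp Require Export all_classical all_reals all_analysis.

Set Implicit Arguments.
Unset Strict Implicit.
Unset Printing Implicit Defensive.

Import Order.TTheory GRing.Theory Num.Theory.

Local Open Scope classical_set_scope.
Local Open Scope ring_scope.
Local Open Scope complex_scope.

Section Geometry.
Context {R : realType} {X : metricType R}.
Implicit Types (a b c : X) (A B S : set X) (delta r : R).

Definition is_geodesic a b (gamma : R -> X) : Prop :=
  [/\ gamma 0 = a, gamma (mdist a b) = b &
      forall s t, s \in `[0, mdist a b] -> t \in `[0, mdist a b] ->
        mdist (gamma s) (gamma t) = `|s - t|].

(* Geodesics are identified with their images. *)
Definition geodesic_segment a b S : Prop :=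
  exists2 gamma : R -> X, is_geodesic a b gamma &
    S = gamma @` [set` `[0, mdist a b]].

Definition geodesic_space : Prop :=
  forall a b, exists S, geodesic_segment a b S.

(* Only the side [a, b] is mentioned: the other two are covered by cyclically
   permuting (a, b, c). *)
Definition hyperbolic delta : Prop :=
  forall a b c Sab Sbc Sca,
    geodesic_segment a b Sab -> geodesic_segment b c Sbc ->
    geodesic_segment c a Sca ->
    forall p, Sab p -> exists2 q, (Sbc `|` Sca) q & mdist p q < delta.

(* Extended-real valued, so that the distance to the empty set is +oo. *)
Definition set_dist A B : \bar R :=
  ereal_inf [set (mdist u.1 u.2)%:E | u in A `*` B].

Definition sphere (o : X) r : set X := [set x | mdist o x = r].

End Geometry.

Arguments geodesic_space {R} X.
Arguments hyperbolic {R} X delta.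

Section GroupAction.
Context {R : realType} {G : groupType} {X : metricType R}.

Definition isometric_action (act : G -> X -> X) : Prop :=
  [/\ forall x, act 1%g x = x,
      forall g h x, act (g * h)%g x = act g (act h x) &
      forall g x y, mdist (act g x) (act g y) = mdist x y].

Definition E_lt (act : G -> X -> X) (o : X) (r : R) : set G :=
  [set g | mdist o (act g o) < r].

Definition L_exists (act : G -> X -> X) (o : X) (A : set X) : set G :=
  [set g | exists2 S, geodesic_segment o (act g o) S & S `&` A !=set0].

Definition L_forall (act : G -> X -> X) (o : X) (r : R) (A : set X) : set G :=
  [set g | exists2 a, A a &
     forall S, geodesic_segment o (act g o) S -> S `&` ball a r !=set0].

End GroupAction.

Section Sums.
Context {R : realType} {T : choiceType}.

(* Unordered sums; meaningful for absolutely summable families. *)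
Definition real_sum (f : T -> R) : R :=
  fine (\esum_(t in [set: T]) (f^\+ t)%:E) -
  fine (\esum_(t in [set: T]) (f^\- t)%:E).

Definition complex_sum (f : T -> R[i]) : R[i] :=
  real_sum (fun t => complex.Re (f t)) +i* real_sum (fun t => complex.Im (f t)).

End Sums.

Section FourierPolynomials.
Context {R : realType} {G : groupType}.
Implicit Types (x v w : G -> R[i]) (T : (G -> R[i]) -> (G -> R[i])).

Definition l2 v : Prop :=
  (\esum_(g in [set: G]) (Normc.normc (v g) ^+ 2)%:E < +oo)%E.

Definition l2_inner v w : R[i] := complex_sum (fun g => v g * (w g)^*).

Definition l2_norm v : R := Num.sqrt (complex.Re (l2_inner v v)).

(* Operators are represented by total maps on functions; only their values on
   l2 matter. *)
Definition bounded_operator T : Prop :=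
  [/\ forall v, l2 v -> l2 (T v),
      forall (c : R[i]) v w, l2 v -> l2 w ->
        T (fun g => c * v g + w g) = (fun g => c * T v g + T w g) &
      exists M : R, forall v, l2 v -> l2_norm (T v) <= M * l2_norm v].

(* The order on R[i] is such that 0 <= z entails that z is real. *)
Definition positive_operator T : Prop :=
  forall v, l2 v -> 0 <= l2_inner (T v) v.

Definition lambda (h : G) v : G -> R[i] := fun g => v (h^-1 * g)%g.

(* sum_g x_g lambda_g is represented by its coefficient function x. *)
Definition fourier_polynomial x : Prop := finite_set [set g | x g != 0].

Definition fourier_op x v : G -> R[i] :=
  fun g => \sum_(h \in [set: G]) x h * lambda h v g.

(* Since lambda_g^* = lambda_(g^-1). *)
Definition fourier_adjoint x : G -> R[i] := fun g => (x g^-1%g)^*.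

Definition is_modulus x T : Prop :=
  [/\ bounded_operator T, positive_operator T &
      forall v, l2 v ->
        T (T v) = fourier_op (fourier_adjoint x) (fourier_op x v)].

(* |x|, the positive square root of x^* x; it exists for every Fourier
   polynomial and is unique as an operator on l2, so the default is never
   used. *)
Definition modulus x : (G -> R[i]) -> (G -> R[i]) :=
  xget (fourier_op x) [set T | is_modulus x T].

Definition delta1 : G -> R[i] := fun g => (g == 1%g)%:R.

(* The canonical trace <T delta_1, delta_1>; tau (fourier_op x) = x_1. *)
Definition tau T : R[i] := T delta1 1%g.

(* The trace of a positive operator is real. *)
Definition Lp_norm (p : nat) x : R :=
  (complex.Re (tau (iter p (modulus x)))) `^ (p%:R^-1).

Definition fourier_proj (E : set G) x : G -> R[i] :=
  fun g => if g \in E then x g else 0.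

(* The norm of fourier_proj E from L^1 to L^q: Fourier polynomials are dense
   in L^1, which is their completion. *)
Definition proj_norm1 (q : nat) (E : set G) : \bar R :=
  ereal_sup [set (Lp_norm q (fourier_proj E x))%:E |
             x in [set x | fourier_polynomial x /\ Lp_norm 1 x <= 1]].

Definition fourier_multiplier {I : choiceType} (L : I -> set G)
    (eps : I -> R[i]) x : G -> R[i] :=
  fun g => \sum_(i \in [set: I]) eps i * fourier_proj (L i) x g.

End FourierPolynomials.

Section Multipliers.
Context {R : realType} {G : groupType} {X : metricType R} {I : choiceType}.
Implicit Types (act : G -> X -> X) (o : X).

Definition H_exists act o (A : I -> set X) :=
  fourier_multiplier (R := R) (fun i => L_exists act o (A i)).

Definition H_forall act o (r : R) (A : I -> set X) :=
  fourier_multiplier (R := R) (fun i => L_forall act o r (A i)).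

Definition kappa act o (q : nat) (r : R) : \bar R :=
  proj_norm1 q (E_lt act o r).

End Multipliers.

(* Main.v *)
Require Import Defs.
From mathcomp Require Import all_boot all_order all_algebra.
From mathcomp Require Import ring lra.

(** The argument is Cotlar's. Put [y = H x] and let [F g] be the sign [eps i] if
    [g] lies in the [i]-th of the sets [L_forall], which are pairwise disjoint
    since the [A i] are [4 delta]-separated. Hyperbolicity of the triangle with
    vertices [o], [g.o] and [g h^-1.o] shows that, when [g] and [h] start through
    [A i] and [A j] and [k = g h^-1] has [|k| >= 2m + 2 delta], either [k] starts
    like [g] or [k^-1] starts like [h]. Outside [E] := [E_{<2m + 2 delta}] this
    gives [(y y')_k = F(k) (x y')_k + F(k^-1)' (y x')_k - F(k) F(k^-1)' (x x')_k],
    a prime denoting adjoints and conjugates, while on [E] the L^2 norm of [y y'] is at most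
    [kappa ||y y'||_1 = kappa ||y||_2^2]. As [||x y'||_2 <= ||x||_4 ||y||_4],
    the norms [a = ||x||_4] and [b = ||y||_4] satisfy
    [b^2 <= kappa a^2 + 2 a b + a^2].

    The modulus of a Fourier polynomial is [sqrt c (1 - Y)], where [Y] is the norm
    limit of the iteration [Y |-> (B + Y^2) / 2] with [B = 1 - x' x / c].
    That [kappa] is finite rests on [|x_g| <= C tau |x|]. *)

Set Implicit Arguments.
Unset Strict Implicit.
Unset Printing Implicit Defensive.

Import Order.TTheory GRing.Theory Num.Theory.

Local Open Scope classical_set_scope.
Local Open Scope ring_scope.

(** * Hyperbolic geometry *)

Section HyperbolicGeometry.
Context {R : realType} {X : metricType R}.
Implicit Types (a b c o p q : X) (A S : set X).

(** The threshold [2m + 2 delta] comes from averaging: if neither [k] nor [k^-1] starts as claimed,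
    [|k|] is less than [2m + 2 delta] plus [|h| - |g|], and also less than [2m + 2 delta] plus
    [|g| - |h|]. The norms for p = 2 and p = 4 are [||x||_2] and the square root of [||x' x||_2],
    plain l2 quantities; a genuine modulus enters only through p = 1. Cotlar's estimate meets p = 1
    only at [y y'], which is positive and so its own modulus. A general modulus matters for one
    purpose: the constant is a real number extracted from the extended real [kappa], which must
    therefore be finite. The bound of a coefficient by [tau |x|] usually comes from the polar
    decomposition; here the inverse of [T = |x|] is replaced by partial sums of a Neumann series, at
    the cost of a factor 2. Since the modulus is a chosen square root, it has to be shown unique,
    and to commute with right translations, before the trace property applies to it. *)

Lemma geodesic_dist a b S p : geodesic_segment a b S -> S p ->
  mdist a p + mdist p b = mdist a b.
Proof.
case=> gamma [g0 g1 giso] -> [t /= tI <-].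
have d0 := mdist_ge0 a b.
have /andP[t0 td] : 0 <= t <= mdist a b by rewrite in_itv in tI.
have in0 : 0 \in `[0, mdist a b] by rewrite in_itv /= lexx.
have ind : mdist a b \in `[0, mdist a b] by rewrite in_itv /= d0 lexx.
have -> : mdist a (gamma t) = t.
  by rewrite -{1}g0 giso// sub0r normrN ger0_norm.
have -> : mdist (gamma t) b = mdist a b - t.
  by rewrite -{1}g1 giso// distrC ger0_norm// subr_ge0.
by rewrite addrC subrK.
Qed.

Lemma geodesic_dist2 a b S p q : geodesic_segment a b S -> S p -> S q ->
  mdist p q = `|mdist a p - mdist a q|.
Proof.
case=> gamma [g0 g1 giso] -> [s /= sI <-] [t /= tI <-].
have d0 := mdist_ge0 a b.
have in0 : 0 \in `[0, mdist a b] by rewrite in_itv /= lexx.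
have dE r : r \in `[0, mdist a b] -> mdist a (gamma r) = r.
  move=> rI; rewrite -{1}g0 giso// sub0r normrN ger0_norm//.
  by move: rI; rewrite in_itv => /andP[].
by rewrite giso// !dE.
Qed.

Lemma geodesic_end a b S : geodesic_segment a b S -> S b.
Proof.
case=> gamma [_ g1 _] ->; exists (mdist a b) => //=.
by rewrite in_itv /= mdist_ge0 lexx.
Qed.

Lemma geodesic_rev a b S : geodesic_segment a b S -> geodesic_segment b a S.
Proof.
case=> gamma [g0 g1 giso] ->.
have flip t : t \in `[0, mdist a b] -> mdist a b - t \in `[0, mdist a b].
  by rewrite !in_itv /= => /andP[? ?]; apply/andP; split; lra.
exists (fun t => gamma (mdist a b - t)).
  split; rewrite ?(metric_sym b a) ?subr0 ?subrr// => s t sI tI.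
  by rewrite giso ?flip// opprB addrC addrA subrK distrC.
apply/seteqP; split=> _ [t /= tI <-]; exists (mdist a b - t) => //=;
  rewrite ?(metric_sym b a) ?flip ?subKr// -1?(metric_sym b a)//.
Qed.

Lemma geodesic_point a : geodesic_segment a a [set a].
Proof.
exists (fun=> a).
  split=> // s t; rewrite mdistxx !in_itv /= => s0 t0.
  by rewrite -(le_anti s0) -(le_anti t0) subrr normr0.
apply/seteqP; split=> [_ ->|_ [t _ <-]]//=.
by exists 0 => //=; rewrite mdistxx in_itv /= lexx.
Qed.

(** The third side of the triangle is the constant geodesic at [b], whose only point already lies on
    [S']. *)
Lemma hyperbolic_bigon delta a b S S' p : hyperbolic X delta ->
  geodesic_segment a b S -> geodesic_segment a b S' -> S p ->
  exists2 q, S' q & mdist p q < delta.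
Proof.
move=> hyp gS gS' Sp.
have [q [/= qb|] pq] := hyp a b b S _ S' gS (geodesic_point b) (geodesic_rev gS') p Sp.
  by exists q => //; rewrite qb; exact: geodesic_end gS'.
by exists q.
Qed.

End HyperbolicGeometry.

(** * Isometric actions and elements starting through a given set *)

Section ActionGeometry.
Context {R : realType} {G : groupType} {X : metricType R}.
Variables (act : G -> X -> X) (o : X) (delta m : R).
Hypothesis iso : isometric_action act.
Hypothesis geo : geodesic_space X.
Hypothesis hyp : hyperbolic X delta.
Implicit Types (A B : set X) (g h k : G).

Let act1 x : act 1%g x = x. Proof. by case: iso. Qed.
Let actM g h x : act (g * h)%g x = act g (act h x). Proof. by case: iso. Qed.
Let actI g x y : mdist (act g x) (act g y) = mdist x y. Proof. by case: iso. Qed.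

Lemma geodesic_act k a b S : geodesic_segment a b S ->
  geodesic_segment (act k a) (act k b) (act k @` S).
Proof.
case=> gamma [g0 g1 giso] ->; exists (fun t => act k (gamma t)).
  by split; rewrite ?g0 ?actI ?g1// => s t sI tI; rewrite actI giso.
by rewrite actI; apply/seteqP; split=> [_ [_ [t tI <-] <-]|_ [t tI <-]];
  [exists t|exists (gamma t) => //; exists t].
Qed.

Lemma mdist_orbitV g : mdist o (act g^-1%g o) = mdist o (act g o).
Proof. by rewrite -(actI g) -actM mulgV act1 metric_sym. Qed.

(** Bigons are [delta]-thin, so the point of [A] met by one geodesic serves as centre for all of
    them. *)
Lemma L_exists_sub_forall A : L_exists act o A `<=` L_forall act o delta A.
Proof.
move=> g [S gS [a [Sa Aa]]]; exists a => // S' gS'.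
have [q S'q aq] := hyperbolic_bigon hyp gS gS' Sa.
by exists q; split=> //; rewrite ballEmdist.
Qed.

(** On one geodesic from [o] to [g.o] there are [p] and [q] within [delta] of [a] and [b]. Their
    distances to [o] lie strictly between [m - delta] and [m + delta], so [p] and [q] are less than
    [2 delta] apart, and [a] and [b] less than [4 delta]. *)
Lemma L_forall_disjoint A B g : A `<=` sphere o m -> B `<=` sphere o m ->
  ((4 * delta)%:E <= set_dist A B)%E ->
  L_forall act o delta A g -> L_forall act o delta B g -> False.
Proof.
move=> Am Bm AB [a Aa ha] [b Bb hb]; have [S gS] := geo o (act g o).
have [p [Sp]] := ha S gS; rewrite ballEmdist /= => ap.
have [q [Sq]] := hb S gS; rewrite ballEmdist /= => bq.
have ab : 4 * delta <= mdist a b.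
  rewrite -lee_fin; apply: le_trans AB _.
  by apply: ereal_inf_lbound; exists (a, b).
clear AB; have pq := geodesic_dist2 gS Sp Sq.
have oa : mdist o a = m by exact: Am.
have ob : mdist o b = m by exact: Bm.
have pq2 : mdist p q < 2 * delta.
  have h1 := metric_triangle o a p; have h2 := metric_triangle o p a.
  have h3 := metric_triangle o b q; have h4 := metric_triangle o q b.
  rewrite (metric_sym p a) in h2; rewrite (metric_sym q b) in h4.
  rewrite pq ltr_norml; apply/andP; split; lra.
have h1 := metric_triangle a p b; have h2 := metric_triangle p q b.
rewrite (metric_sym q b) in h2; lra.
Qed.

(** In the triangle [o], [g.o], [k.o] the third side is the translate by [k] of a geodesic from [o]
    to [h.o]. If some geodesic to [k.o] avoids the ball at [a], thinness puts [a] within [delta] of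
    a point [k q'] of this translate. Then [|k| < m + delta + |q'|], where
    [|q'| = |h| - dist(q', h.o)] and [dist(q', h.o) > |g| - m - delta]. *)
Lemma product_starts_like A g h : A `<=` sphere o m -> L_exists act o A g ->
  L_forall act o delta A (g * h^-1)%g \/
  mdist o (act (g * h^-1)%g o) <
    2 * m + 2 * delta + mdist o (act h o) - mdist o (act g o).
Proof.
move=> Am [S gS [a [Sa Aa]]]; set k := (g * h^-1)%g.
have [lk|nlk] := pselect (L_forall act o delta A k); [by left|right].
have [S' gS' S'a] : exists2 S', geodesic_segment o (act k o) S' &
    forall q, S' q -> ~ ball a delta q.
  apply: contrapT => nS'; apply: nlk; exists a => // S' gS'.
  by apply: contrapT => e; apply: nS'; exists S' => // q S'q aq; apply: e; exists q.
have [Sh gSh] := geo o (act h o).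
have gkh : act k (act h o) = act g o by rewrite -actM /k mulgVK.
have gT := geodesic_rev (geodesic_act k gSh); rewrite gkh in gT.
have [q [/= [q' Shq' <-]|S'q] aq] := hyp gS gT (geodesic_rev gS') Sa; last first.
  by exfalso; apply: (S'a q S'q); rewrite ballEmdist.
have oa : mdist o a = m by exact: Am.
have h1 := geodesic_dist gS Sa; have h2 := geodesic_dist gSh Shq'.
have h3 := metric_triangle o a (act k o).
have h4 := metric_triangle a (act k q') (act k o).
have h5 := metric_triangle a (act k q') (act g o).
rewrite -gkh actI in h5; rewrite actI (metric_sym q' o) in h4.
rewrite gkh in h5; move: aq h1 h2 h3 h4 h5; rewrite oa; lra.
Qed.

(** [g h^-1] and its inverse [h g^-1] have the same length. If both alternatives failed, the two
    bounds on it would add up to a value below [2 (2m + 2 delta)] for its double. *)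
Lemma product_starts_like_factor A B g h : A `<=` sphere o m -> B `<=` sphere o m ->
  L_exists act o A g -> L_exists act o B h ->
  ~ E_lt act o (2 * m + 2 * delta) (g * h^-1)%g ->
  L_forall act o delta A (g * h^-1)%g \/ L_forall act o delta B (h * g^-1)%g.
Proof.
move=> Am Bm Ag Bh /= /negP; rewrite -leNgt => far.
have [|d1] := product_starts_like h Am Ag; first by left.
have [|d2] := product_starts_like g Bm Bh; first by right.
have e : mdist o (act (h * g^-1)%g o) = mdist o (act (g * h^-1)%g o).
  by rewrite -mdist_orbitV invgM invgK.
by exfalso; rewrite e in d2; lra.
Qed.

End ActionGeometry.

(** * Unordered sums and square-summable functions *)

Section RealSum.
Context {R : realType} {T : choiceType}.
Implicit Types f g : T -> R.

Definition abs_summable f := (\esum_(t in [set: T]) `|f t|%:E < +oo)%E.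

Lemma abs_summable_le f g :
  (forall t, `|f t| <= `|g t|) -> abs_summable g -> abs_summable f.
Proof. by move=> fg; apply: le_lt_trans; apply: le_esum => t _; rewrite lee_fin. Qed.

Lemma abs_summableD f g :
  abs_summable f -> abs_summable g -> abs_summable (fun t => f t + g t).
Proof.
move=> sf sg; apply: (@le_lt_trans _ _
  (\esum_(t in [set: T]) (`|f t|%:E + `|g t|%:E))%E).
  by apply: le_esum => t _; rewrite -EFinD lee_fin ler_normD.
by rewrite esumD ?lte_add_pinfty// => t _; rewrite lee_fin.
Qed.

Lemma esumZ (c : R) f : 0 <= c -> (forall t, 0 <= f t) ->
  (\esum_(t in [set: T]) (c * f t)%:E = c%:E * \esum_(t in [set: T]) (f t)%:E)%E.
Proof.
rewrite le0r => /predU1P[->|c0] f0.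
  by rewrite mul0e esum1// => t _; rewrite mul0r.
(* This inequality for all positive factors also yields the converse, through [c^-1] and the family
   [c * f]. *)
have le_ (d : R) (h : T -> R) : 0 < d ->
    (\esum_(t in [set: T]) (d * h t)%:E <= d%:E * \esum_(t in [set: T]) (h t)%:E)%E.
  move=> d0; apply: ge_ereal_sup => _ [X [finX _] <-].
  rewrite fsumEFin// -mulr_fsumr EFinM lee_pmul2l// -fsumEFin//.
  by apply: ereal_sup_ubound; exists X.
apply/eqP; rewrite eq_le le_//=.
have ci : (0 < c^-1)%R by rewrite invr_gt0.
rewrite -[leRHS]mul1e -(divff (lt0r_neq0 c0)) EFinM -muleA lee_pmul2l//.
apply: le_trans (le_ _ _ ci).
by apply: le_esum => t _; rewrite mulKf ?lt0r_neq0.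
Qed.

Lemma abs_summableZ (c : R) f : abs_summable f -> abs_summable (fun t => c * f t).
Proof.
move=> sf; rewrite /abs_summable.
under eq_esum do rewrite normrM.
rewrite esumZ//; apply: lte_mul_pinfty => //.
Qed.

Lemma abs_summable_pos f : abs_summable f -> abs_summable (f^\+)%R.
Proof.
apply: abs_summable_le => t; rewrite ger0_norm ?funrpos_ge0//.
by rewrite ge_max ler_norm normr_ge0.
Qed.

Lemma abs_summable_neg f : abs_summable f -> abs_summable (f^\-)%R.
Proof.
apply: abs_summable_le => t; rewrite ger0_norm ?funrneg_ge0//.
by rewrite ge_max -[X in _ <= X]normrN ler_norm normr_ge0.
Qed.

Lemma abs_summable_fin f : (forall t, 0 <= f t) -> abs_summable f ->
  (\esum_(t in [set: T]) (f t)%:E)%E \is a fin_num.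
Proof.
move=> f0 sf; rewrite ge0_fin_numE; last by apply: esum_ge0 => t _; rewrite lee_fin.
by apply: le_lt_trans sf; apply: le_esum => t _; rewrite lee_fin ler_norm.
Qed.

(** Any splitting into nonnegative summable families computes the sum. Additivity depends on this
    freedom, as the positive part of [f + g] is not the sum of the positive parts. *)
Lemma real_sumB f g : (forall t, 0 <= f t) -> (forall t, 0 <= g t) ->
  abs_summable f -> abs_summable g ->
  real_sum (fun t => f t - g t) =
  fine (\esum_(t in [set: T]) (f t)%:E) - fine (\esum_(t in [set: T]) (g t)%:E).
Proof.
move=> f0 g0 sf sg.
have fE : (\esum_(t in [set: T]) (f t)%:E = \esum_(t in [set: T]) `|f t|%:E)%E.
  by apply: eq_esum => t _; rewrite ger0_norm.
have gE : (\esum_(t in [set: T]) (g t)%:E = \esum_(t in [set: T]) `|g t|%:E)%E.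
  by apply: eq_esum => t _; rewrite ger0_norm.
have fin h : abs_summable h -> (\esum_(t in [set: T]) `|h t|%:E)%E \is a fin_num.
  by move=> sh; rewrite ge0_fin_numE// esum_ge0.
have sfg : abs_summable (fun t => f t - g t).
  apply: abs_summableD => //; apply: abs_summable_le sg => t.
  by rewrite normrN.
have EB := @esumB _ _ [set: T] (EFin \o f) (EFin \o g) sf sg
  (fun t _ => f0 t) (fun t _ => g0 t).
transitivity (fine (\esum_(t in [set: T]) (f t)%:E - \esum_(t in [set: T]) (g t)%:E)%E);
  last by rewrite fineB ?fE ?gE ?fin.
rewrite -[X in _ = fine X]EB /real_sum.
have pE : (\esum_(t in [set: T]) (((EFin \o f) \- (EFin \o g))^\+ t) =
   \esum_(t in [set: T]) ((fun t => f t - g t)%R^\+ t)%:E)%E.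
  by apply: eq_esum => t _; rewrite funeposE /funrpos /= EFin_max.
have nE : (\esum_(t in [set: T]) (((EFin \o f) \- (EFin \o g))^\- t) =
   \esum_(t in [set: T]) ((fun t => f t - g t)%R^\- t)%:E)%E.
  by apply: eq_esum => t _; rewrite funenegE /funrneg /= EFin_max.
rewrite pE nE fineB//; apply: abs_summable_fin.
- exact: funrpos_ge0.
- exact: abs_summable_pos.
- exact: funrneg_ge0.
- exact: abs_summable_neg.
Qed.

Lemma real_sum_ge0E f : (forall t, 0 <= f t) ->
  real_sum f = fine (\esum_(t in [set: T]) (f t)%:E).
Proof.
move=> f0; rewrite /real_sum [X in _ - fine X]esum1 ?subr0.
  by congr fine; apply: eq_esum => t _; rewrite /funrpos max_l.
by move=> t _; rewrite /funrneg max_r// oppr_le0.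
Qed.

Lemma real_sum_ge0 f : (forall t, 0 <= f t) -> 0 <= real_sum f.
Proof. by move=> f0; rewrite real_sum_ge0E// fine_ge0// esum_ge0// => t _; rewrite lee_fin. Qed.

Lemma real_sumD f g : abs_summable f -> abs_summable g ->
  real_sum (fun t => f t + g t) = real_sum f + real_sum g.
Proof.
move=> sf sg.
have fp := funrpos_ge0 f; have gp := funrpos_ge0 g.
have fn := funrneg_ge0 f; have gn := funrneg_ge0 g.
have [sfp sfn] := (abs_summable_pos sf, abs_summable_neg sf).
have [sgp sgn] := (abs_summable_pos sg, abs_summable_neg sg).
have -> : (fun t => f t + g t) =
    (fun t => ((f^\+)%R t + (g^\+)%R t) - ((f^\-)%R t + (g^\-)%R t)).
  by rewrite -[in LHS](funrposBneg f) -[in LHS](funrposBneg g); apply/funext => t; rewrite !fctE; ring.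
rewrite real_sumB; do ?[by move=> t; rewrite addr_ge0|exact: abs_summableD].
under eq_esum do rewrite EFinD.
rewrite esumD; do ?[by move=> t _; rewrite lee_fin].
under [X in _ - fine X]eq_esum do rewrite EFinD.
rewrite esumD; do ?[by move=> t _; rewrite lee_fin].
rewrite !fineD ?abs_summable_fin// /real_sum; ring.
Qed.

Lemma real_sumZ (c : R) f : abs_summable f ->
  real_sum (fun t => c * f t) = c * real_sum f.
Proof.
move=> sf.
have posZ (d : R) : 0 <= d -> real_sum (fun t => d * f t) = d * real_sum f.
  move=> d0; have -> : (fun t => d * f t) =
      (fun t => d * (f^\+)%R t - d * (f^\-)%R t).
    by rewrite -[in LHS](funrposBneg f); apply/funext => t; rewrite -mulrBr.
  rewrite real_sumB; do ?[by move=> t; rewrite mulr_ge0 ?funrpos_ge0 ?funrneg_ge0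
    |exact/abs_summableZ/abs_summable_pos|exact/abs_summableZ/abs_summable_neg].
  rewrite !esumZ//; do ?[exact: funrpos_ge0|exact: funrneg_ge0].
  have p_fin := abs_summable_fin (funrpos_ge0 f) (abs_summable_pos sf).
  have n_fin := abs_summable_fin (funrneg_ge0 f) (abs_summable_neg sf).
  by rewrite !fineM// -mulrBr.
have [/posZ//|/ltW c0] := leP 0 c.
(* For negative [c], the factor [- c] is already covered and the two families cancel. *)
have s0 : real_sum (fun t => c * f t + - c * f t) = 0.
  rewrite (_ : (fun _ => _) = fun t => 0 * f t) ?posZ ?mul0r//.
  by apply/funext => t; rewrite mulNr subrr mul0r.
move: s0; rewrite real_sumD; do ?exact: abs_summableZ.
rewrite [X in _ + X]posZ ?oppr_ge0// => /eqP.
by rewrite mulNr subr_eq0 => /eqP.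
Qed.

Lemma real_sum_fin f (A : set T) : finite_set A ->
  (forall t, ~ A t -> f t = 0) -> real_sum f = \sum_(t \in A) f t.
Proof.
move=> finA f0.
have sumA (h : T -> R) : (forall t, 0 <= h t) -> (forall t, ~ A t -> h t = 0) ->
    fine (\esum_(t in [set: T]) (h t)%:E) = \sum_(t \in A) h t.
  move=> h0 hA; rewrite (_ : \esum_(t in _) _ = \esum_(t in A) (h t)%:E)%E.
    by rewrite esum_fset ?fsumEFin// => t _; rewrite lee_fin.
  rewrite [RHS]esum_mkcond; apply: eq_esum => t _.
  by case: ifPn => //; rewrite notin_setE => /hA ->.
rewrite /real_sum !sumA; do ?[exact: funrpos_ge0|exact: funrneg_ge0].
- rewrite [in RHS](_ : f = (fun t => (f^\+)%R t + - (f^\-)%R t)); last first.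
    by rewrite -[in LHS](funrposBneg f).
  rewrite fsbig_split//=; congr (_ + _).
  by rewrite !fsbig_finite//= sumrN.
- by move=> t /f0; rewrite /funrneg => ->; rewrite oppr0 maxxx.
- by move=> t /f0; rewrite /funrpos => ->; rewrite maxxx.
Qed.

End RealSum.

Lemma real_sum_reindex {R : realType} {S T : choiceType} (e : S -> T) (f : T -> R) :
  set_bij [set: S] [set: T] e -> real_sum (fun s => f (e s)) = real_sum f.
Proof. by move=> be; rewrite /real_sum !(reindex_esum [set: S] [set: T] e). Qed.

Section ComplexDot.
Local Open Scope complex_scope.
Context {R : realType}.
Implicit Types a b c : R[i].

(** The inner product of [R[i]] as a real plane. [rdot a a] is the squared modulus as an element of
    [R], which keeps estimates out of the partial order of [R[i]]. *)
Definition rdot a b : R := complex.Re (a * b^*%C).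

Lemma rdotE a b :
  rdot a b = complex.Re a * complex.Re b + complex.Im a * complex.Im b.
Proof. by case: a b => [ar ai] [br bi]; rewrite /rdot /= mulrN opprK. Qed.

Lemma rdotC a b : rdot a b = rdot b a.
Proof. by rewrite !rdotE; ring. Qed.

Lemma rdotDl a b c : rdot (a + b) c = rdot a c + rdot b c.
Proof. by rewrite /rdot mulrDl raddfD. Qed.

Lemma rdotMl a b c : rdot (a * b) c = rdot b (a^*%C * c).
Proof. by rewrite !rdotE; case: a b c => [? ?] [? ?] [? ?] /=; ring. Qed.

Lemma rdot_real (r : R) a b : rdot (r%:C * a) b = r * rdot a b.
Proof. by rewrite !rdotE; case: a => x y /=; ring. Qed.

Lemma rdot_ge0 a : 0 <= rdot a a.
Proof. by rewrite rdotE -!expr2 addr_ge0 ?sqr_ge0. Qed.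

Lemma rdot_eq0 a : rdot a a = 0 -> a = 0.
Proof.
case: a => x y; rewrite rdotE /= -!expr2 => /eqP.
by rewrite paddr_eq0 ?sqr_ge0// !sqrf_eq0 => /andP[/eqP -> /eqP ->].
Qed.

Lemma rdot_norm a b : `|rdot a b| <= rdot a a + rdot b b.
Proof.
rewrite !rdotE; case: a b => [a1 a2] [b1 b2] /=.
have := (sqr_ge0 (a1 + b1), sqr_ge0 (a2 + b2), sqr_ge0 (a1 - b1), sqr_ge0 (a2 - b2)).
have := (sqr_ge0 a1, sqr_ge0 a2, sqr_ge0 b1, sqr_ge0 b2).
by rewrite ler_norml => -[[[? ?] ?] ?] [[[? ?] ?] ?]; apply/andP; split; lra.
Qed.

Lemma rdotMM a b : rdot (a * b) (a * b) = rdot a a * rdot b b.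
Proof. by rewrite !rdotE; case: a b => [ar ai] [br bi] /=; ring. Qed.

Lemma rdotJ a b : rdot a^*%C b^*%C = rdot a b.
Proof. by rewrite !rdotE; case: a b => [ar ai] [br bi] /=; rewrite mulrNN. Qed.

Lemma normc_sqr a : Normc.normc a ^+ 2 = rdot a a.
Proof.
by case: a => x y; rewrite /= sqr_sqrtr ?addr_ge0 ?sqr_ge0// rdotE /= -!expr2.
Qed.

Lemma normc_leP a b : (`|a| <= `|b|) = (rdot a a <= rdot b b).
Proof.
rewrite !normc_def lecR !rdotE -!expr2 ler_sqrt// addr_ge0 ?sqr_ge0//.
Qed.

End ComplexDot.

Lemma quadratic_ge0_discr {R : realType} (a b c : R) : 0 <= c ->
  (forall t, 0 <= a + 2 * t * b + t ^+ 2 * c) -> b ^+ 2 <= a * c.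
Proof.
move=> c0 h; have := c0; rewrite le_eqVlt => /predU1P[c00|cp].
  have a0 : 0 <= a by have := h 0; rewrite mulr0 mul0r expr0n mul0r !addr0.
  have [->|b0] := eqVneq b 0; first by rewrite expr0n mulr_ge0.
  (* At this [t] the affine function takes the value -1. *)
  have := h (- (a + 1) / (2 * b)); rewrite -c00 mulr0 addr0.
  rewrite (_ : 2 * _ * b = - (a + 1)); last by field.
  by rewrite leNgt => /negP[]; lra.
have := h (- b / c); rewrite (_ : a + _ + _ = a - b ^+ 2 / c); last first.
  by field; rewrite lt0r_neq0.
by rewrite subr_ge0 ler_pdivrMr.
Qed.

(** * The real Hilbert space structure of l2 *)

Section L2.
Local Open Scope complex_scope.
Context {R : realType} {G : groupType}.
Local Notation V := (G -> R[i]).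
Implicit Types u v w : V.

(** Norms, adjoints and Cauchy-Schwarz can be read from the real part; the imaginary part is
    recovered by rotating one argument by [i], see [l2_innerE]. *)
Definition rin v w : R := complex.Re (l2_inner v w).

Lemma rinE v w : rin v w = real_sum (fun g => rdot (v g) (w g)).
Proof. by []. Qed.

Lemma rinC v w : rin v w = rin w v.
Proof. by rewrite !rinE; congr real_sum; apply/funext => g; rewrite rdotC. Qed.

Lemma l2P v : l2 v <-> abs_summable (fun g => rdot (v g) (v g)).
Proof.
rewrite /l2 /abs_summable; set E := (X in (X < _)%E); set F := (X in _ <-> is_true (X < _)%E).
suff -> : E = F by [].
by apply: eq_esum => g _; rewrite ger0_norm ?rdot_ge0// normc_sqr.
Qed.

Lemma l2_le u v : (forall g, rdot (u g) (u g) <= rdot (v g) (v g)) -> l2 v -> l2 u.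
Proof.
move=> uv /l2P lv; apply/l2P; apply: abs_summable_le lv => g.
by rewrite !ger0_norm ?rdot_ge0.
Qed.

Lemma l2_summable v w : l2 v -> l2 w -> abs_summable (fun g => rdot (v g) (w g)).
Proof.
move=> /l2P lv /l2P lw; apply: abs_summable_le (abs_summableD lv lw) => g.
by rewrite (ger0_norm (addr_ge0 (rdot_ge0 _) (rdot_ge0 _))) rdot_norm.
Qed.

Lemma l2D v w : l2 v -> l2 w -> l2 (v + w).
Proof.
move=> lv lw; apply/l2P.
have h := abs_summableD (abs_summableZ 2 (proj1 (l2P _) lv))
                        (abs_summableZ 2 (proj1 (l2P _) lw)).
apply: abs_summable_le h => g.
rewrite !ger0_norm ?addr_ge0 ?mulr_ge0 ?rdot_ge0//.
rewrite (_ : (v + w) g = v g + w g)// !rdotE; case: (v g) (w g) => [a b] [c d] /=.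
by have := (sqr_ge0 (a - c), sqr_ge0 (b - d)) => -[? ?]; lra.
Qed.

Lemma l2Z c v : l2 v -> l2 (c *: v).
Proof.
move=> /l2P lv; apply/l2P; apply: abs_summable_le (abs_summableZ (rdot c c) lv) => g.
by rewrite [rdot _ _](rdotMM c (v g)).
Qed.

Lemma l2_0 : l2 (0 : V).
Proof. by apply/l2P; rewrite /abs_summable esum1 ?ltry// => g _; rewrite /rdot mul0r normr0. Qed.

Lemma l2N v : l2 v -> l2 (- v).
Proof. by rewrite -scaleN1r; exact: l2Z. Qed.

Lemma l2B v w : l2 v -> l2 w -> l2 (v - w).
Proof. by move=> lv lw; apply/l2D/l2N. Qed.

Lemma l2_sum (I : Type) (r : seq I) (F : I -> V) :
  (forall i, l2 (F i)) -> l2 (\sum_(i <- r) F i).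
Proof. by move=> lF; elim/big_ind: _ => //; [exact: l2_0|exact: l2D]. Qed.

Lemma rinDl u v w : l2 u -> l2 v -> l2 w -> rin (u + v) w = rin u w + rin v w.
Proof.
move=> lu lv lw; rewrite !rinE -real_sumD; do ?exact: l2_summable.
by congr real_sum; apply/funext => g; rewrite -rdotDl.
Qed.

Lemma rinDr u v w : l2 u -> l2 v -> l2 w -> rin w (u + v) = rin w u + rin w v.
Proof. by move=> lu lv lw; rewrite !(rinC w) rinDl. Qed.

Lemma rinZl c v w : rin (c *: v) w = rin v (c^*%C *: w).
Proof. by rewrite !rinE; congr real_sum; apply/funext => g; exact: rdotMl. Qed.

Lemma rin_realZl (r : R) v w : l2 v -> l2 w -> rin (r%:C *: v) w = r * rin v w.
Proof.
move=> lv lw; rewrite !rinE -real_sumZ; last exact: l2_summable.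
by congr real_sum; apply/funext => g; exact: rdot_real.
Qed.

Lemma rin_realZr (r : R) v w : l2 v -> l2 w -> rin v (r%:C *: w) = r * rin v w.
Proof. by move=> lv lw; rewrite rinC rin_realZl// rinC. Qed.

Lemma rinNl v w : l2 v -> l2 w -> rin (- v) w = - rin v w.
Proof.
move=> lv lw; have -> : - v = (-1)%:C *: v.
  by apply/funext => g; rewrite !fctE; apply/eqP; rewrite eq_complex;
    case: (v g) => x y /=; rewrite !mulN1r !mul0r addr0 subr0 !eqxx.
by rewrite rin_realZl// mulN1r.
Qed.

Lemma rinNr v w : l2 v -> l2 w -> rin v (- w) = - rin v w.
Proof. by move=> lv lw; rewrite rinC rinNl// rinC. Qed.

Lemma rinBl u v w : l2 u -> l2 v -> l2 w -> rin (u - v) w = rin u w - rin v w.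
Proof. by move=> lu lv lw; rewrite rinDl ?rinNl//; apply: l2N. Qed.

Lemma rinBr u v w : l2 u -> l2 v -> l2 w -> rin w (u - v) = rin w u - rin w v.
Proof. by move=> lu lv lw; rewrite !(rinC w) rinBl. Qed.

Lemma rin0l v : rin 0 v = 0.
Proof.
by rewrite rinE (@real_sum_fin _ _ _ classical_sets.set0)// => [|g _]; rewrite ?fsbig_set0// /rdot mul0r.
Qed.

Lemma rin_ge0 v : 0 <= rin v v.
Proof. by apply: real_sum_ge0 => g; exact: rdot_ge0. Qed.

Lemma l2_innerE v w : l2_inner v w = rin v w +i* rin v ('i%C *: w).
Proof.
rewrite /l2_inner /complex_sum; congr Complex.
rewrite rinE; congr real_sum; apply/funext => g; rewrite rdotE fctE.
by case: (v g) (w g) => [a b] [c d] /=; ring.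
Qed.

Definition dlt (s : G) : V := fun g => (g == s)%:R.

Lemma rin_dlt v s : rin v (dlt s) = complex.Re (v s).
Proof.
rewrite rinE (@real_sum_fin _ _ _ [set s]) ?fsbig_set1//.
  by rewrite rdotE /dlt eqxx /= mulr1 mulr0 addr0.
move=> g /eqP gs; rewrite /dlt (negPf gs) rdotE /=; ring.
Qed.

Lemma l2_fin v (A : set G) : finite_set A -> (forall g, ~ A g -> v g = 0) -> l2 v.
Proof.
move=> finA vA; apply/l2P; rewrite /abs_summable.
rewrite (_ : \esum_(t in _) _ = \esum_(t in A) `|rdot (v t) (v t)|%:E)%E.
  by rewrite esum_fset// fsumEFin// ltry.
rewrite [RHS]esum_mkcond; apply: eq_esum => g _.
case: ifPn => //; rewrite notin_setE => /vA ->.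
by rewrite /rdot mul0r normr0.
Qed.

Lemma l2_dlt s : l2 (dlt s).
Proof.
apply: (@l2_fin _ [set s]) => // g /eqP gs.
by rewrite /dlt (negPf gs).
Qed.

Lemma l2_esum_fin v : l2 v ->
  (\esum_(g in [set: G]) (rdot (v g) (v g))%:E)%E \is a fin_num.
Proof.
move=> /l2P lv; apply: (abs_summable_fin (f := fun g => rdot (v g) (v g))) => // g.
exact: rdot_ge0.
Qed.

Lemma rin_esum v : l2 v ->
  (rin v v)%:E = (\esum_(g in [set: G]) (rdot (v g) (v g))%:E)%E.
Proof.
move=> lv; rewrite rinE real_sum_ge0E => [|g]; last exact: rdot_ge0.
by rewrite fineK// l2_esum_fin.
Qed.

Lemma rin_coord v s : l2 v -> rdot (v s) (v s) <= rin v v.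
Proof.
move=> lv; rewrite -lee_fin rin_esum//.
apply: esum_ge; exists [set s]; first by split.
by rewrite fsbig_set1.
Qed.

Lemma rin_eq0 v : l2 v -> rin v v = 0 -> v = 0.
Proof.
move=> lv v0; apply/funext => g; apply: rdot_eq0; apply/eqP.
by rewrite eq_le rdot_ge0 -v0 rin_coord.
Qed.

Lemma le_rin u v : (forall g, rdot (u g) (u g) <= rdot (v g) (v g)) -> l2 v ->
  rin u u <= rin v v.
Proof.
move=> uv lv; have lu := l2_le uv lv.
by rewrite -lee_fin !rin_esum//; apply: le_esum => g _; rewrite lee_fin.
Qed.

Lemma rin_sqrD u v : l2 u -> l2 v ->
  rin (u + v) (u + v) = rin u u + 2 * rin u v + rin v v.
Proof.
move=> lu lv; have luv := l2D lu lv.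
rewrite rinDl// !rinDr// (rinC v u); ring.
Qed.

Lemma rin_sqrB u v : l2 u -> l2 v ->
  rin (u - v) (u - v) = rin u u - 2 * rin u v + rin v v.
Proof.
move=> lu lv; rewrite rin_sqrD//; last exact: l2N.
have lN := l2N lv; rewrite !rinNr// rinNl// opprK; ring.
Qed.

Lemma rin_CS u v : l2 u -> l2 v -> rin u v ^+ 2 <= rin u u * rin v v.
Proof.
move=> lu lv; apply: quadratic_ge0_discr; first exact: rin_ge0.
move=> t; have := rin_ge0 (u + t%:C *: v); rewrite rin_sqrD//; last exact: l2Z.
have lt := l2Z t%:C lv.
by rewrite !rin_realZr// rin_realZl// mulrA [_ * (_ * rin v v)]mulrA -expr2.
Qed.

Lemma l2_normE v : l2_norm v = Num.sqrt (rin v v).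
Proof. by []. Qed.

Lemma l2_norm_ge0 v : 0 <= l2_norm v.
Proof. exact: sqrtr_ge0. Qed.

Lemma l2_norm_sqr v : l2_norm v ^+ 2 = rin v v.
Proof. by rewrite sqr_sqrtr// rin_ge0. Qed.

Lemma l2_norm_le v (M : R) : 0 <= M -> (l2_norm v <= M) = (rin v v <= M ^+ 2).
Proof. by move=> M0; rewrite -l2_norm_sqr ler_sqr// nnegrE l2_norm_ge0. Qed.

Lemma l2_norm_eq0 v : l2 v -> l2_norm v = 0 -> v = 0.
Proof.
by move=> lv v0; apply: rin_eq0 => //; rewrite -l2_norm_sqr v0 expr0n.
Qed.

Lemma rin_le_norm u v : l2 u -> l2 v -> `|rin u v| <= l2_norm u * l2_norm v.
Proof.
move=> lu lv; rewrite -ler_sqr ?nnegrE ?mulr_ge0 ?l2_norm_ge0//.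
by rewrite exprMn !l2_norm_sqr real_normK ?num_real// rin_CS.
Qed.

Lemma l2_normD u v : l2 u -> l2 v -> l2_norm (u + v) <= l2_norm u + l2_norm v.
Proof.
move=> lu lv; rewrite l2_norm_le ?addr_ge0 ?l2_norm_ge0// rin_sqrD//.
rewrite sqrrD !l2_norm_sqr lerD2r lerD2l -[leRHS]mulr_natl ler_pM2l//.
by rewrite (le_trans (ler_norm _))// rin_le_norm.
Qed.

Lemma l2_normZ c v : l2 v -> l2_norm (c *: v) = Num.sqrt (rdot c c) * l2_norm v.
Proof.
move=> lv; rewrite !l2_normE -sqrtrM ?rdot_ge0//; congr Num.sqrt.
rewrite !rinE -(real_sumZ (rdot c c) (proj1 (l2P v) lv)).
by congr real_sum; apply/funext => g; exact: rdotMM.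
Qed.

Lemma l2_norm_realZ (r : R) v : l2 v -> l2_norm (r%:C *: v) = `|r| * l2_norm v.
Proof. by move=> lv; rewrite l2_normZ// rdotE /= mulr0 addr0 -expr2 sqrtr_sqr. Qed.

Lemma l2_normN v : l2 v -> l2_norm (- v) = l2_norm v.
Proof. by move=> lv; rewrite !l2_normE rinNl ?rinNr ?opprK//; exact: l2N. Qed.

Lemma l2_norm0 : l2_norm (0 : V) = 0.
Proof.
have := l2_norm_realZ 0 l2_0; rewrite rmorph0 scale0r => ->.
by rewrite normr0 mul0r.
Qed.

Lemma l2_normB u v : l2 u -> l2 v -> l2_norm (u - v) <= l2_norm u + l2_norm v.
Proof. by move=> lu lv; rewrite -(l2_normN lv) l2_normD//; exact: l2N. Qed.

Lemma le_l2_norm u v : (forall g, rdot (u g) (u g) <= rdot (v g) (v g)) -> l2 v ->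
  l2_norm u <= l2_norm v.
Proof. by move=> uv lv; rewrite ler_sqrt ?rin_ge0// le_rin. Qed.

End L2.

(* The limit is the supremum of the lower bounds [a n - e n]. *)
Lemma nested_limit {R : realType} (a e : nat -> R) :
  (forall n m, (n <= m)%N -> `|a m - a n| <= e n) ->
  exists l, forall n, `|l - a n| <= e n.
Proof.
move=> ae.
have h n m : a n - e n <= a m + e m.
  have [nm|/ltnW mn] := leqP n m.
    have := ae _ _ nm; have := ae m m (leqnn m); rewrite subrr normr0 ler_norml.
    by move=> ? /andP[? ?]; lra.
  have := ae _ _ mn; have := ae n n (leqnn n); rewrite subrr normr0 ler_norml.
  by move=> ? /andP[? ?]; lra.
pose S := [set x | exists n, x = a n - e n].
have supS : has_sup S.
  split; first by exists (a 0%N - e 0%N); exists 0%N.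
  by exists (a 0%N + e 0%N) => _ [n ->].
exists (sup S) => n; rewrite ler_distl; apply/andP; split.
  by apply: sup_upper_bound => //; exists n.
by apply: sup_le_ub => [|_ [m ->]//]; case: supS.
Qed.

(** * Completeness of l2 *)

Section Completeness.
Local Open Scope complex_scope.
Context {R : realType} {G : groupType}.
Local Notation V := (G -> R[i]).
Implicit Types u v w : V.

Lemma fourier_proj_le (A : set G) v g :
  rdot (fourier_proj A v g) (fourier_proj A v g) <= rdot (v g) (v g).
Proof. by rewrite /fourier_proj; case: ifP => // _; rewrite {1}/rdot mul0r rdot_ge0. Qed.

Lemma fourier_projD (A : set G) v w :
  fourier_proj A (v + w) = fourier_proj A v + fourier_proj A w.
Proof.
by apply/funext => g; rewrite !fctE /fourier_proj; case: ifP => //; rewrite addr0.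
Qed.

Lemma rin_fourier_proj (A : set G) v : finite_set A ->
  rin (fourier_proj A v) (fourier_proj A v) = \sum_(g \in A) rdot (v g) (v g).
Proof.
move=> finA; rewrite rinE (real_sum_fin finA) => [|g Ag].
  by apply: eq_fsbigr => g gA; rewrite /fourier_proj gA.
by rewrite /fourier_proj memNset// /rdot mul0r.
Qed.

Lemma l2_fourier_proj_fin (A : set G) v : finite_set A -> l2 (fourier_proj A v).
Proof.
move=> finA; apply: (l2_fin finA) => g Ag.
by rewrite /fourier_proj memNset.
Qed.

Lemma l2_of_restrictions v (M : R) : 0 <= M ->
  (forall A, finite_set A -> l2_norm (fourier_proj A v) <= M) ->
  l2 v /\ l2_norm v <= M.
Proof.
move=> M0 vM.
have vM' : (\esum_(g in [set: G]) (rdot (v g) (v g))%:E <= (M ^+ 2)%:E)%E.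
  apply: ge_ereal_sup => _ [A [finA _] <-].
  rewrite fsumEFin// lee_fin -rin_fourier_proj// -l2_norm_le//.
  exact: vM.
have lv : l2 v.
  apply/l2P; apply: le_lt_trans (ltry (M ^+ 2)); apply: le_trans vM'.
  by apply: le_esum => g _; rewrite ger0_norm ?rdot_ge0.
by split=> //; rewrite l2_norm_le// -lee_fin rin_esum.
Qed.

(** Real and imaginary parts converge coordinatewise by [nested_limit]. On a finite set [A] this
    convergence is uniform, so the restriction of [w - u k] splits into that of [u m - u k], of norm
    at most [e k], and that of [w - u m], small for a suitable late [m]. The resulting bound [e k]
    does not depend on [A]. *)
Lemma l2_complete (u : nat -> V) (e : nat -> R) :
  (forall n, l2 (u n)) ->
  (forall n m, (n <= m)%N -> l2_norm (u m - u n) <= e n) ->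
  (forall n eps, 0 < eps -> exists2 m, (n <= m)%N & e m <= eps) ->
  exists w, l2 w /\ forall n, l2_norm (w - u n) <= e n.
Proof.
move=> lu ue e0.
have coord n m g : (n <= m)%N ->
    complex.Re (u m g - u n g) ^+ 2 + complex.Im (u m g - u n g) ^+ 2 <= e n ^+ 2.
  move=> nm; have lB : l2 (u m - u n) by exact: l2B.
  rewrite !expr2 -rdotE -expr2; apply: le_trans (rin_coord g lB) _.
  by rewrite -l2_norm_le ?ue// (le_trans _ (ue _ _ nm))// l2_norm_ge0.
have e_ge0 n : 0 <= e n by apply: le_trans (ue n n (leqnn n)); exact: l2_norm_ge0.
have re g n m : (n <= m)%N -> `|complex.Re (u m g) - complex.Re (u n g)| <= e n.
  move=> nm; rewrite -ler_sqr ?nnegrE// real_normK ?num_real// -raddfB.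
  by apply: le_trans (coord n m g nm); rewrite lerDl sqr_ge0.
have im g n m : (n <= m)%N -> `|complex.Im (u m g) - complex.Im (u n g)| <= e n.
  move=> nm; rewrite -ler_sqr ?nnegrE// real_normK ?num_real// -raddfB.
  by apply: le_trans (coord n m g nm); rewrite lerDr sqr_ge0.
have /choice[wr wrP] := fun g => nested_limit (re g).
have /choice[wi wiP] := fun g => nested_limit (im g).
pose w : V := fun g => wr g +i* wi g.
have wu n g : rdot ((w - u n) g) ((w - u n) g) <= 2 * e n ^+ 2.
  have sq (z : R) : `|z| <= e n -> z ^+ 2 <= e n ^+ 2.
    by move=> zn; rewrite -real_normK ?num_real// ler_sqr ?nnegrE.
  rewrite rdotE -!expr2 mulr_natl mulr2n.
  have := lerD (sq _ (wrP g n)) (sq _ (wiP g n)).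
  by rewrite (_ : (w - u n) g = (wr g +i* wi g) - u n g)//; case: (u n g).
suff wun k : l2 (w - u k) /\ l2_norm (w - u k) <= e k.
  exists w; split=> [|n]; last by case: (wun n).
  by rewrite -(subrK (u 0%N) w); apply: l2D => //; case: (wun 0%N).
apply: l2_of_restrictions => // A finA.
set c := (size (finmap.enum_fset (fset_set A)))%:R : R.
have c0 : 0 <= c by rewrite ler0n.
(* Each of the [c] coordinates in [A] contributes at most [2 * e m ^+ 2], the 2 counting real and
   imaginary parts. *)
have restr m : l2_norm (fourier_proj A (w - u m)) <= Num.sqrt (2 * c) * e m.
  rewrite l2_norm_le ?mulr_ge0 ?sqrtr_ge0// rin_fourier_proj// exprMn.
  rewrite sqr_sqrtr ?mulr_ge0// fsbig_finite//=.
  rewrite (_ : 2 * c * e m ^+ 2 = \sum_(g <- finmap.enum_fset (fset_set A)) 2 * e m ^+ 2).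
    by apply: ler_sum => g _; exact: wu.
  by rewrite big_const_seq count_predT iter_addr_0 /c mulrAC mulr_natr.
apply/ler_addgt0Pl => eps eps0.
have k0 : 0 < Num.sqrt (2 * c) + 1 by rewrite ltr_wpDl// sqrtr_ge0.
have [m nm em] := e0 k _ (divr_gt0 eps0 k0).
rewrite (_ : w - u k = (u m - u k) + (w - u m)); last by rewrite [RHS]addrC addrA subrK.
rewrite fourier_projD.
have lA v : l2 (fourier_proj A v) by exact: l2_fourier_proj_fin.
rewrite [leRHS]addrC; apply: le_trans (l2_normD (lA _) (lA _)) _; apply: lerD.
  apply: le_trans (ue _ _ nm); apply: le_l2_norm (l2B (lu m) (lu k)) => g.
  exact: fourier_proj_le.
apply: le_trans (restr m) _; rewrite -[leRHS](divfK (lt0r_neq0 k0)) [leRHS]mulrC.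
by apply: ler_pM => //; rewrite ?sqrtr_ge0// lerDl.
Qed.

End Completeness.

(** * Bounded operators and square roots *)

Lemma conj_iE (R : realType) : 'i%C^*%C = -1 * 'i%C :> R[i].
Proof. by apply/eqP; rewrite eq_complex /=; apply/andP; split; apply/eqP; ring. Qed.

Lemma conj_iM (R : realType) : 'i%C^*%C * 'i%C = 1 :> R[i].
Proof. by apply/eqP; rewrite eq_complex /=; apply/andP; split; apply/eqP; ring. Qed.

Section Operators.
Local Open Scope complex_scope.
Context {R : realType} {G : groupType}.
Local Notation V := (G -> R[i]).
Implicit Types (u v w : V) (S T Z : V -> V) (M : R).

(** [bounded_operator] with an explicit nonnegative bound, since the square root iteration tracks
    its exact value. *)
Definition bounded_by M T : Prop :=
  [/\ forall v, l2 v -> l2 (T v),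
      forall (c : R[i]) v w, l2 v -> l2 w -> T (c *: v + w) = c *: T v + T w,
      0 <= M &
      forall v, l2 v -> l2_norm (T v) <= M * l2_norm v].

Definition self_adjoint T : Prop :=
  forall v w, l2 v -> l2 w -> rin (T v) w = rin v (T w).

Definition commute_on_l2 S T : Prop := forall v, l2 v -> S (T v) = T (S v).

Lemma bounded_operatorP T : bounded_operator T <-> exists M, bounded_by M T.
Proof.
split=> [[lT linT [M TM]]|[M [lT linT M0 TM]]]; last by split=> //; exists M.
exists (Num.max M 0); split=> // [|v lv]; first by rewrite le_max lexx orbT.
by rewrite (le_trans (TM _ lv))// ler_wpM2r ?l2_norm_ge0// le_max lexx.
Qed.

Section BoundedTheory.
Variables (M : R) (T : V -> V).
Hypothesis bT : bounded_by M T.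

Lemma bd_l2 v : l2 v -> l2 (T v). Proof. by case: bT => h _ _ _; exact: h. Qed.

Lemma bd_norm v : l2 v -> l2_norm (T v) <= M * l2_norm v.
Proof. by case: bT => _ _ _ h; exact: h. Qed.

Lemma bd_ge0 : 0 <= M. Proof. by case: bT. Qed.

Lemma bd_linear c v w : l2 v -> l2 w -> T (c *: v + w) = c *: T v + T w.
Proof. by case: bT => _ h _ _; exact: h. Qed.

Lemma bd0 : T 0 = 0.
Proof.
have := bd_linear 1 l2_0 l2_0; rewrite !scale1r addr0 => /eqP.
by rewrite -subr_eq0 opprD addNKr oppr_eq0 => /eqP.
Qed.

Lemma bdZ c v : l2 v -> T (c *: v) = c *: T v.
Proof. by move=> lv; rewrite -[c *: v]addr0 bd_linear ?bd0 ?addr0//; exact: l2_0. Qed.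

Lemma bdD v w : l2 v -> l2 w -> T (v + w) = T v + T w.
Proof. by move=> lv lw; have := bd_linear 1 lv lw; rewrite !scale1r. Qed.

Lemma bdN v : l2 v -> T (- v) = - T v.
Proof. by move=> lv; rewrite -scaleN1r bdZ// scaleN1r. Qed.

Lemma bdB v w : l2 v -> l2 w -> T (v - w) = T v - T w.
Proof. by move=> lv lw; rewrite bdD ?bdN//; exact: l2N. Qed.

Lemma bd_sum (I : Type) (r : seq I) (F : I -> V) : (forall i, l2 (F i)) ->
  T (\sum_(i <- r) F i) = \sum_(i <- r) T (F i).
Proof.
move=> lF; elim: r => [|i r IH]; first by rewrite !big_nil bd0.
by rewrite !big_cons bdD ?IH//; exact: l2_sum.
Qed.

End BoundedTheory.

Lemma bounded_id : bounded_by 1 (fun v => v).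
Proof. by split=> // v _; rewrite mul1r. Qed.

Lemma bounded_comp M N S T : bounded_by M S -> bounded_by N T ->
  bounded_by (M * N) (fun v => S (T v)).
Proof.
move=> bS bT; have lT := bd_l2 bT.
split=> [v lv|c v w lv lw||v lv].
- exact/(bd_l2 bS)/lT.
- by rewrite (bd_linear bT)// (bd_linear bS)//; exact: lT.
- exact: mulr_ge0 (bd_ge0 bS) (bd_ge0 bT).
- rewrite (le_trans (bd_norm bS (lT _ lv)))// -mulrA ler_wpM2l ?(bd_ge0 bS)//.
  exact: (bd_norm bT).
Qed.

Lemma bounded_add M N S T : bounded_by M S -> bounded_by N T ->
  bounded_by (M + N) (fun v => S v + T v).
Proof.
move=> bS bT; have [lS lT] := (bd_l2 bS, bd_l2 bT).
split=> [v lv|c v w lv lw||v lv].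
- by apply: l2D; [exact: lS|exact: lT].
- by rewrite (bd_linear bT)// (bd_linear bS)// scalerDr addrACA.
- exact: addr_ge0 (bd_ge0 bS) (bd_ge0 bT).
- rewrite (le_trans (l2_normD (lS _ lv) (lT _ lv)))// mulrDl.
  by apply: lerD; [exact: (bd_norm bS)|exact: (bd_norm bT)].
Qed.

Lemma bounded_scale M (r : R) T : bounded_by M T ->
  bounded_by (`|r| * M) (fun v => r%:C *: T v).
Proof.
move=> bT; have lT := bd_l2 bT.
split=> [v lv|c v w lv lw||v lv].
- by apply/l2Z; exact: lT.
- by rewrite (bd_linear bT)// scalerDr !scalerA mulrC.
- by rewrite mulr_ge0// (bd_ge0 bT).
- by rewrite (l2_norm_realZ r (lT _ lv)) -mulrA ler_wpM2l// (bd_norm bT).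
Qed.

Lemma bounded_sub M N S T : bounded_by M S -> bounded_by N T ->
  bounded_by (M + N) (fun v => S v - T v).
Proof.
move=> bS bT; have [lS lT] := (bd_l2 bS, bd_l2 bT).
split=> [v lv|c v w lv lw||v lv].
- by apply: l2B; [exact: lS|exact: lT].
- by rewrite (bd_linear bT)// (bd_linear bS)// scalerBr addrACA opprD.
- exact: addr_ge0 (bd_ge0 bS) (bd_ge0 bT).
- rewrite (le_trans (l2_normB (lS _ lv) (lT _ lv)))// mulrDl.
  by apply: lerD; [exact: (bd_norm bS)|exact: (bd_norm bT)].
Qed.

(* For complex scalars positivity forces self-adjointness: polarize with
   [v + w] and [v + i w] in the imaginary part. *)
Lemma positive_self_adjoint M T :
  bounded_by M T -> positive_operator T -> self_adjoint T.
Proof.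
move=> bT pT v w lv lw.
have im0 u : l2 u -> rin (T u) ('i%C *: u) = 0.
  by move=> lu; have := pT u lu; rewrite l2_innerE => /ger0_Im.
have [lTv lTw] := (bd_l2 bT lv, bd_l2 bT lw).
pose iw : V := 'i%C *: w; pose iTw : V := 'i%C *: T w; pose iv : V := 'i%C *: v.
have [liw [liTw liv]] : l2 iw /\ (l2 iTw /\ l2 iv).
  by split; [|split]; apply: l2Z.
have liiw : l2 ('i%C *: iw) by exact: l2Z.
have lviw := l2D lv liw.
have := im0 _ lviw; rewrite (bdD bT)// (bdZ bT)// scalerDr -/iTw -/iv.
have lviw' := l2D liv liiw.
rewrite rinDl// !rinDr// (im0 v lv) add0r.
have ii (a b : V) : rin ('i%C *: a) ('i%C *: b) = rin a b.
  by rewrite rinZl scalerA conj_iM scale1r.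
rewrite !ii (im0 w lw) addr0 /iw scalerA -expr2 sqr_i scaleN1r rinNr//.
by rewrite (rinC (T w)) addrC => /eqP; rewrite subr_eq0 => /eqP.
Qed.

Lemma positive_rin_ge0 T v : positive_operator T -> l2 v -> 0 <= rin (T v) v.
Proof. by move=> pT lv; have := pT v lv; rewrite l2_innerE lecE /= => /andP[]. Qed.

(** Positivity also asks [l2_inner (T v) v] to be real; by self-adjointness its imaginary part
    equals its own negative. *)
Lemma positive_of_self_adjoint M T : bounded_by M T -> self_adjoint T ->
  (forall v, l2 v -> 0 <= rin (T v) v) -> positive_operator T.
Proof.
move=> bT sT pT v lv; rewrite l2_innerE lecE /= pT// andbT.
have liv : l2 ('i%C *: v) by exact: l2Z.
have lTv := bd_l2 bT lv.
have h : rin (T v) ('i%C *: v) = - rin (T v) ('i%C *: v).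
  by rewrite {1}sT// (bdZ bT)// rinC rinZl conj_iE mulN1r scaleNr rinNr//.
by apply/eqP; move: h; lra.
Qed.

(** Cauchy-Schwarz for the semidefinite form of [T], from the discriminant of its value at
    [u + t v]. *)
Lemma form_CS M T u v : bounded_by M T -> positive_operator T -> l2 u -> l2 v ->
  rin (T u) v ^+ 2 <= rin (T u) u * rin (T v) v.
Proof.
move=> bT pT lu lv; have sT := positive_self_adjoint bT pT.
apply: quadratic_ge0_discr => [|t]; first exact: positive_rin_ge0.
have ltv : l2 (t%:C *: v) by exact: l2Z.
have [lTu lTv] := (bd_l2 bT lu, bd_l2 bT lv).
have := positive_rin_ge0 pT (l2D lu ltv).
rewrite (bdD bT)// (bdZ bT)//; have ltTv : l2 (t%:C *: T v) by exact: l2Z.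
rewrite rinDl//; last exact: l2D.
rewrite !rinDr// !rin_realZl// !rin_realZr// (sT v u)// (rinC v).
by congr (0 <= _); ring.
Qed.

Lemma form_eq0 M T v : bounded_by M T -> positive_operator T -> l2 v ->
  rin (T v) v = 0 -> T v = 0.
Proof.
move=> bT pT lv Tv0; have lTv := bd_l2 bT lv.
apply: rin_eq0 => //; have := form_CS bT pT lv lTv.
rewrite Tv0 mul0r => h; apply/eqP.
by rewrite -sqrf_eq0 eq_le h sqr_ge0.
Qed.

(** For [w = S v - T v], commutation gives [S w + T w = S S v - T T v = 0]. Two nonnegative forms
    then sum to zero at [w], so [S w = T w = 0] and [<w, w> = <S w, v> - <T w, v> = 0]. *)
Lemma positive_sqrt_unique M N S T :
  bounded_by M S -> bounded_by N T -> positive_operator S -> positive_operator T ->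
  commute_on_l2 S T -> (forall v, l2 v -> S (S v) = T (T v)) ->
  forall v, l2 v -> S v = T v.
Proof.
move=> bS bT pS pT cST SST v lv.
have [lS lT] := (bd_l2 bS, bd_l2 bT).
pose w : V := S v - T v.
have [lSv lTv] := (lS _ lv, lT _ lv).
have lw : l2 w by exact: l2B.
have STw : S w + T w = 0.
  rewrite (bdB bS)// (bdB bT)// SST// cST//.
  by rewrite addrC addrA subrK subrr.
have : rin (S w) w + rin (T w) w = 0.
  rewrite -rinDl ?STw//; [|exact: lS|exact: lT].
  exact: rin0l.
move/eqP; rewrite paddr_eq0 ?positive_rin_ge0// => /andP[/eqP Sw /eqP Tw].
have Sw0 := form_eq0 bS pS lw Sw; have Tw0 := form_eq0 bT pT lw Tw.
have sS := positive_self_adjoint bS pS; have sT := positive_self_adjoint bT pT.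
apply/eqP; rewrite -subr_eq0 -/w; apply/eqP/rin_eq0 => //.
rewrite {2}/w rinBr// -sS// -sT// Sw0 Tw0 subrr//.
Qed.

End Operators.

(** * Square roots by iteration *)

Section ScalarIteration.
Context {R : realType}.

(** The iteration [(B + Y^2) / 2] for the scalar [B = 1]. For a contraction [B] it majorizes the
    norms of the operator iterates and of their differences. *)
Fixpoint sqrt_iter_scalar (n : nat) : R :=
  if n is n'.+1 then (1 + sqrt_iter_scalar n' ^+ 2) / 2 else 0.

Lemma sqrt_iter_scalar_bounds n : 0 <= sqrt_iter_scalar n <= 1.
Proof.
elim: n => [|n /andP[h0 h1]] /=; first by rewrite lexx ler01.
by apply/andP; split; nra.
Qed.

Lemma sqrt_iter_scalar_mono n m : (n <= m)%N ->
  sqrt_iter_scalar n <= sqrt_iter_scalar m.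
Proof.
have step k : sqrt_iter_scalar k <= sqrt_iter_scalar k.+1.
  elim: k => [|k IH]; first by case/andP: (sqrt_iter_scalar_bounds 1).
  have /andP[h0 h1] := sqrt_iter_scalar_bounds k.
  rewrite [leLHS](_ : _ = (1 + sqrt_iter_scalar k ^+ 2) / 2)//.
  rewrite [leRHS](_ : _ = (1 + sqrt_iter_scalar k.+1 ^+ 2) / 2)//.
  by rewrite ler_pM2r ?invr_gt0// lerD2l ler_sqr ?nnegrE// (le_trans h0).
elim: m => [|m IH]; first by rewrite leqn0 => /eqP->.
by rewrite leq_eqVlt => /predU1P[->//|/IH/le_trans]; apply.
Qed.

Definition sqrt_iter_gap n : R := sup (range sqrt_iter_scalar) - sqrt_iter_scalar n.

Lemma sqrt_iter_has_sup : has_sup (range sqrt_iter_scalar).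
Proof.
split; first by exists (sqrt_iter_scalar 0); exists 0%N.
by exists 1 => _ [n _ <-]; case/andP: (sqrt_iter_scalar_bounds n).
Qed.

Lemma sqrt_iter_gap_ge n m :
  sqrt_iter_scalar m - sqrt_iter_scalar n <= sqrt_iter_gap n.
Proof.
rewrite lerD2r; apply: sup_upper_bound; first exact: sqrt_iter_has_sup.
by exists m.
Qed.

Lemma sqrt_iter_gap_ge0 n : 0 <= sqrt_iter_gap n.
Proof. by have := sqrt_iter_gap_ge n n; rewrite subrr. Qed.

Lemma sqrt_iter_gap_le1 n : sqrt_iter_scalar n + sqrt_iter_gap n <= 1.
Proof.
rewrite addrC subrK; apply: sup_le_ub; first by case: sqrt_iter_has_sup.
by move=> _ [k _ <-]; case/andP: (sqrt_iter_scalar_bounds k).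
Qed.

Lemma sqrt_iter_gap_small n eps : 0 < eps ->
  exists2 m, (n <= m)%N & sqrt_iter_gap m <= eps.
Proof.
move=> eps0; have [_ [m _ <-] hm] := @sup_adherent R _ _ eps0 sqrt_iter_has_sup.
exists (maxn n m); first exact: leq_maxl.
have := sqrt_iter_scalar_mono (leq_maxr n m); rewrite /sqrt_iter_gap; lra.
Qed.

(** The device for passing to the limit: the gaps decrease and become arbitrarily small. *)
Lemma le0_of_gap (a K : R) :
  (forall n, exists2 m, (n <= m)%N & a <= K * (sqrt_iter_gap n + sqrt_iter_gap m)) ->
  a <= 0.
Proof.
move=> h; apply/ler_addgt0Pl => eps eps0; rewrite addr0.
have K0 : 0 < `|K| + 1 by rewrite ltr_wpDl.
have e0 : 0 < eps / (`|K| + 1) / 2 by rewrite !divr_gt0.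
have [n _ hn] := sqrt_iter_gap_small 0 e0.
have [m nm am] := h n; apply: le_trans am _.
have gm : sqrt_iter_gap m <= sqrt_iter_gap n.
  by rewrite lerD2l lerN2 sqrt_iter_scalar_mono.
have g2 : sqrt_iter_gap n + sqrt_iter_gap m <= eps / (`|K| + 1).
  by rewrite [leRHS]splitr; apply: lerD => //; exact: le_trans hn.
apply: le_trans (_ : (`|K| + 1) * (sqrt_iter_gap n + sqrt_iter_gap m) <= _).
  have g0 := addr_ge0 (sqrt_iter_gap_ge0 n) (sqrt_iter_gap_ge0 m).
  apply: ler_wpM2r g0 _ _ _; by have := ler_norm K; lra.
by rewrite mulrC -ler_pdivlMr.
Qed.

End ScalarIteration.

Section SquareRoot.
Local Open Scope complex_scope.
Context {R : realType} {G : groupType}.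
Local Notation V := (G -> R[i]).
Variable B : V -> V.
Hypothesis bB : bounded_by 1 B.
Hypothesis sB : self_adjoint B.
Local Notation y := (@sqrt_iter_scalar R).
Local Notation gap := (@sqrt_iter_gap R).

(* Solves [Y = (B + Y^2) / 2], that is [(1 - Y)^2 = 1 - B]. *)
Fixpoint sqrt_iter (n : nat) (v : V) : V :=
  if n is n'.+1 then (2^-1)%:C *: (B v + sqrt_iter n' (sqrt_iter n' v)) else 0.

Lemma sqrt_iter_bounded n : bounded_by (y n) (sqrt_iter n).
Proof.
elim: n => [|n IH] /=.
  split=> // [v _|c v w _ _|v lv]; first exact: l2_0.
    by rewrite scaler0 addr0.
  by rewrite l2_norm0 mul0r.
have := bounded_scale 2^-1 (bounded_add bB (bounded_comp IH IH)).
by rewrite ger0_norm ?invr_ge0// -expr2 mulrC.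
Qed.

Lemma sqrt_iter_self_adjoint n : self_adjoint (sqrt_iter n).
Proof.
elim: n => [|n IH] v w lv lw; first by rewrite /= rin0l rinC rin0l.
have ln := bd_l2 (sqrt_iter_bounded n); have lB := bd_l2 bB.
have [lnv lnw] := (ln _ lv, ln _ lw).
have [lnnv lnnw] := (ln _ lnv, ln _ lnw).
have [lBv lBw] := (lB _ lv, lB _ lw).
rewrite /= rin_realZl ?rin_realZr//; do ?exact: l2D.
by rewrite rinDl// rinDr// sB// IH// IH.
Qed.

Lemma sqrt_iter_commute (M : R) (Z : V -> V) n : bounded_by M Z ->
  commute_on_l2 Z B -> commute_on_l2 Z (sqrt_iter n).
Proof.
move=> bZ cZB; elim: n => [|n IH] v lv; first by rewrite /= (bd0 bZ).
have ln := bd_l2 (sqrt_iter_bounded n).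
have [lnv lBv] := (ln _ lv, bd_l2 bB lv).
have lnnv := ln _ lnv.
by rewrite /= (bdZ bZ) ?(bdD bZ)// ?cZB ?IH// ?IH//; exact: l2D.
Qed.

(** For consecutive iterates, [S1^2 - S^2 = S1 (S1 - S) + (S1 - S) S], so the scalar identity
    [y1^2 - y^2 = (y1 + y) (y1 - y)] carries over to norms. *)
Lemma sqrt_iter_step n v : l2 v ->
  l2_norm (sqrt_iter n.+1 v - sqrt_iter n v) <= (y n.+1 - y n) * l2_norm v.
Proof.
elim: n v => [|n IH] v lv.
  by rewrite /= !subr0; have := bd_norm (sqrt_iter_bounded 1) lv.
have [bn bn1] := (sqrt_iter_bounded n, sqrt_iter_bounded n.+1).
have [ln ln1] := (bd_l2 bn, bd_l2 bn1).
pose S := sqrt_iter n; pose S1 := sqrt_iter n.+1.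
have lSv := ln _ lv; have lS1v := ln1 _ lv.
have -> : sqrt_iter n.+2 v - sqrt_iter n.+1 v =
    (2^-1)%:C *: (S1 (S1 v - S v) + (S1 (S v) - S (S v))).
  rewrite [sqrt_iter n.+2 v](_ : _ = (2^-1)%:C *: (B v + S1 (S1 v)))//.
  rewrite [sqrt_iter n.+1 v](_ : _ = (2^-1)%:C *: (B v + S (S v)))//.
  have -> : S1 (S1 v - S v) = S1 (S1 v) - S1 (S v) by exact: (bdB bn1 lS1v lSv).
  by rewrite -scalerBr addrA subrK opprD addrACA subrr add0r.
have ld : l2 (S1 v - S v) by exact: l2B.
have ld1 : l2 (S1 (S v) - S (S v)) by apply: l2B; [exact: ln1|exact: ln].
have lS1d := ln1 _ ld.
rewrite l2_norm_realZ; last exact: l2D.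
rewrite ger0_norm ?invr_ge0//.
have h1 := bd_norm bn1 ld; have h2 := IH _ lv; have h3 := IH _ lSv.
have h4 := bd_norm bn lv; have h5 := l2_normD lS1d ld1.
have /andP[y0 _] := sqrt_iter_scalar_bounds (R := R) n.
have /andP[y10 _] := sqrt_iter_scalar_bounds (R := R) n.+1.
have yy : y n <= y n.+1 := sqrt_iter_scalar_mono (leqnSn n).
have -> : y n.+2 - y n.+1 = 2^-1 * (y n.+1 ^+ 2 - y n ^+ 2).
  by rewrite [y n.+2]/= -/(y n.+1) [X in _ - X](_ : _ = (1 + y n ^+ 2) / 2)//; field.
rewrite -mulrA ler_wpM2l ?invr_ge0//.
apply: le_trans h5 _.
have h1' : l2_norm (S1 (S1 v - S v)) <= y n.+1 * ((y n.+1 - y n) * l2_norm v).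
  by apply: le_trans h1 _; rewrite ler_wpM2l.
have h3' : l2_norm (S1 (S v) - S (S v)) <= (y n.+1 - y n) * (y n * l2_norm v).
  by apply: le_trans h3 _; rewrite ler_wpM2l ?subr_ge0.
by apply: le_trans (lerD h1' h3') _; rewrite le_eqVlt; apply/orP; left; apply/eqP; ring.
Qed.

Lemma sqrt_iter_cauchy n m v : (n <= m)%N -> l2 v ->
  l2_norm (sqrt_iter m v - sqrt_iter n v) <= (y m - y n) * l2_norm v.
Proof.
move=> nm lv; have ln k := bd_l2 (sqrt_iter_bounded k) lv.
elim: m nm => [|m IH].
  by rewrite leqn0 => /eqP ->; rewrite !subrr mul0r l2_norm0.
rewrite leq_eqVlt => /predU1P[->|]; first by rewrite !subrr mul0r l2_norm0.
rewrite ltnS => /IH h.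
rewrite -(subrK (sqrt_iter m v) (sqrt_iter m.+1 v)) -addrA.
apply: le_trans (l2_normD (l2B (ln m.+1) (ln m)) (l2B (ln m) (ln n))) _.
apply: le_trans (lerD (sqrt_iter_step m lv) h) _.
by rewrite -mulrDl addrA subrK.
Qed.

(** The limit is picked vector by vector; by [sqrt_limitP] the default 0 can only occur outside
    l2. *)
Definition sqrt_limit (v : V) : V :=
  xget 0 [set w | l2 w /\ forall n, l2_norm (w - sqrt_iter n v) <= gap n * l2_norm v].

Lemma sqrt_limitP v : l2 v ->
  l2 (sqrt_limit v) /\
  forall n, l2_norm (sqrt_limit v - sqrt_iter n v) <= gap n * l2_norm v.
Proof.
move=> lv; have [|||w [lw hw]] := @l2_complete R G (sqrt_iter^~ v) (fun n => gap n * l2_norm v).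
- by move=> n; exact: bd_l2 (sqrt_iter_bounded n) _ lv.
- move=> n m nm; apply: le_trans (sqrt_iter_cauchy nm lv) _.
  by rewrite ler_wpM2r ?l2_norm_ge0// sqrt_iter_gap_ge.
- move=> n eps eps0; have v1 : 0 < l2_norm v + 1 by rewrite ltr_wpDl// l2_norm_ge0.
  have [m nm hm] := sqrt_iter_gap_small n (divr_gt0 eps0 v1).
  exists m => //; rewrite -[leRHS](divfK (lt0r_neq0 v1)).
  by apply: ler_pM => //; rewrite ?sqrt_iter_gap_ge0 ?l2_norm_ge0// lerDl.
- by rewrite /sqrt_limit; case: xgetP => [w1 _ []//|/(_ w)[]].
Qed.

(** Linearity, the fixed point equation and commutation all follow from this, by approximating the
    candidate with iterates. The index [m] is separate from [n] because the fixed point equation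
    shifts it by one. *)
Lemma sqrt_limit_unique v w (K : R) : l2 v -> l2 w ->
  (forall n, exists2 m, (n <= m)%N & l2_norm (w - sqrt_iter m v) <= K * gap n) ->
  w = sqrt_limit v.
Proof.
move=> lv lw h; have [ll hl] := sqrt_limitP lv.
have ld := l2B lw ll.
apply/eqP; rewrite -subr_eq0; apply/eqP/l2_norm_eq0 => //.
apply/eqP; rewrite eq_le l2_norm_ge0 andbT.
apply: (@le0_of_gap R _ (`|K| + l2_norm v)) => n.
have [m nm hm] := h n; exists m => //.
have lm := bd_l2 (sqrt_iter_bounded m) lv.
have -> : w - sqrt_limit v = (w - sqrt_iter m v) - (sqrt_limit v - sqrt_iter m v).
  by rewrite opprB addrA subrK.
apply: le_trans (l2_normB (l2B lw lm) (l2B ll lm)) _.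
apply: le_trans (lerD hm (hl m)) _.
have [gn gm] := (sqrt_iter_gap_ge0 (R := R) n, sqrt_iter_gap_ge0 (R := R) m).
have Kn := ler_norm K; have v0 := l2_norm_ge0 v.
have a1 : K * gap n <= `|K| * gap n by rewrite ler_wpM2r.
have a2 : 0 <= `|K| * gap m by rewrite mulr_ge0.
have a3 : 0 <= l2_norm v * gap n by rewrite mulr_ge0.
lra.
Qed.

Lemma sqrt_limit_bounded : bounded_by 1 sqrt_limit.
Proof.
split=> [v lv|c v w lv lw||v lv] //; first by case: (sqrt_limitP lv).
  have lcv := l2Z c lv; have lcvw := l2D lcv lw.
  have [llv hv] := sqrt_limitP lv; have [llw hw] := sqrt_limitP lw.
  have lclv := l2Z c llv; have lres := l2D lclv llw.
  symmetry; apply: (sqrt_limit_unique (K := Num.sqrt (rdot c c) * l2_norm v + l2_norm w)) => // n.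
  exists n => //; have bn := sqrt_iter_bounded n.
  have [lnv lnw] := (bd_l2 bn lv, bd_l2 bn lw).
  rewrite (bd_linear bn)// opprD addrACA -scalerBr.
  have ldv := l2B llv lnv; have lcd := l2Z c ldv.
  apply: le_trans (l2_normD lcd (l2B llw lnw)) _.
  rewrite l2_normZ// mulrDl -mulrA; apply: lerD; last by rewrite mulrC.
  by rewrite ler_wpM2l ?sqrtr_ge0// mulrC.
have [llv hv] := sqrt_limitP lv; rewrite mul1r.
have l1 := bd_l2 (sqrt_iter_bounded 0) lv.
rewrite -(subrK (sqrt_iter 0 v) (sqrt_limit v)).
apply: le_trans (l2_normD (l2B llv l1) l1) _.
apply: le_trans (lerD (hv 0%N) (bd_norm (sqrt_iter_bounded 0) lv)) _.
rewrite -mulrDl -[leRHS]mul1r ler_wpM2r ?l2_norm_ge0// addrC.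
exact: sqrt_iter_gap_le1.
Qed.

Lemma sqrt_limit_fixpoint v : l2 v ->
  sqrt_limit v = (2^-1)%:C *: (B v + sqrt_limit (sqrt_limit v)).
Proof.
move=> lv; have lY := bd_l2 sqrt_limit_bounded.
have [lYv hv] := sqrt_limitP lv; have [lYYv hYv] := sqrt_limitP lYv.
have lBv := bd_l2 bB lv; have lS := l2D lBv lYYv.
symmetry; apply: (sqrt_limit_unique (K := l2_norm (sqrt_limit v) + l2_norm v)) => //.
  exact: l2Z.
move=> n; exists n.+1 => //; have bn := sqrt_iter_bounded n.
have ln := bd_l2 bn; have [lnv lnYv] := (ln _ lv, ln _ lYv).
rewrite /= -scalerBr opprD addrACA subrr add0r.
have ld := l2B lYv lnv.
rewrite l2_norm_realZ; last by apply: l2B => //; exact: ln.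
rewrite ger0_norm ?invr_ge0//.
(* [Y Y v - Y_n Y_n v] splits as [(Y - Y_n) Y v + Y_n (Y v - Y_n v)], where [Y_n] has norm at most
   1. *)
rewrite -(subrK (sqrt_iter n (sqrt_limit v)) (sqrt_limit (sqrt_limit v))) -addrA.
rewrite -(bdB bn)//.
have lnd := ln _ ld.
have h1 := l2_normD (l2B lYYv lnYv) lnd.
have h2 := hYv n; have h3 := bd_norm bn ld; have h4 := hv n.
have /andP[y0 y1] := sqrt_iter_scalar_bounds (R := R) n.
have g0 := sqrt_iter_gap_ge0 (R := R) n.
have h5 : y n * l2_norm (sqrt_limit v - sqrt_iter n v) <= gap n * l2_norm v.
  apply: le_trans h4; rewrite ler_piMl ?l2_norm_ge0//.
have h6 := l2_norm_ge0 (sqrt_limit (sqrt_limit v) - sqrt_iter n (sqrt_limit v) +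
   sqrt_iter n (sqrt_limit v - sqrt_iter n v)).
rewrite mulrDl ![_ * gap n]mulrC; lra.
Qed.

Lemma sqrt_limit_self_adjoint : self_adjoint sqrt_limit.
Proof.
move=> v w lv lw; apply/eqP; rewrite -subr_eq0 -normr_le0.
have [lYv hv] := sqrt_limitP lv; have [lYw hw] := sqrt_limitP lw.
apply: (@le0_of_gap R _ (l2_norm v * l2_norm w)) => n; exists n => //.
have [lnv lnw] := (bd_l2 (sqrt_iter_bounded n) lv, bd_l2 (sqrt_iter_bounded n) lw).
have -> : rin (sqrt_limit v) w - rin v (sqrt_limit w) =
    rin (sqrt_limit v - sqrt_iter n v) w - rin v (sqrt_limit w - sqrt_iter n w).
  by rewrite rinBl// rinBr// (sqrt_iter_self_adjoint n lv lw); ring.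
apply: le_trans (ler_normB _ _) _; rewrite mulrDr; apply: lerD.
  apply: le_trans (rin_le_norm (l2B lYv lnv) lw) _.
  apply: le_trans (ler_wpM2r (l2_norm_ge0 w) (hv n)) _.
  by rewrite [leRHS]mulrC mulrA.
apply: le_trans (rin_le_norm lv (l2B lYw lnw)) _.
by rewrite -mulrA ler_wpM2l ?l2_norm_ge0// mulrC.
Qed.

Lemma sqrt_limit_commute (M : R) (Z : V -> V) : bounded_by M Z ->
  commute_on_l2 Z B -> commute_on_l2 Z sqrt_limit.
Proof.
move=> bZ cZB v lv; have lZ := bd_l2 bZ; have lZv := lZ _ lv.
have [lYv hv] := sqrt_limitP lv.
apply: (sqrt_limit_unique (K := M * l2_norm v)) => //; first exact: lZ.
move=> n; exists n => //; have lnv := bd_l2 (sqrt_iter_bounded n) lv.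
rewrite -(sqrt_iter_commute n bZ cZB)// -(bdB bZ)//.
apply: le_trans (bd_norm bZ (l2B lYv lnv)) _.
by rewrite -mulrA ler_wpM2l ?(bd_ge0 bZ)// mulrC.
Qed.

End SquareRoot.

(** * Convolution by Fourier polynomials *)

Lemma conjcM {R : realType} (a b : R[i]) : (a * b)^*%C = a^*%C * b^*%C.
Proof.
by case: a b => [? ?] [? ?]; apply/eqP; rewrite eq_complex /=;
  apply/andP; split; apply/eqP; ring.
Qed.

Section Convolution.
Local Open Scope complex_scope.
Context {R : realType} {G : groupType}.
Local Notation V := (G -> R[i]).
Implicit Types (u v w x y : V) (g h k : G).

Local Notation "x ** v" := (fourier_op x v) (at level 40, left associativity).
Local Notation adj := fourier_adjoint.

(** Right translations commute with every left convolution ([fourier_op_rtrans]), and operators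
    commuting with them all have the trace property ([trace_comm]). *)
Definition rtrans k v : V := fun g => v (g * k)%g.

Definition support_seq x : seq G :=
  finmap.enum_fset (fset_set [set g | x g != 0]).

Lemma fsbig_support x (F : G -> R[i]) : fourier_polynomial x ->
  (forall g, x g = 0 -> F g = 0) ->
  \sum_(g \in [set: G]) F g = \sum_(g <- support_seq x) F g.
Proof.
move=> fx F0; rewrite -fsbig_finite//; symmetry; apply: fsbig_widen => //.
by move=> g [_ /= /negP]; rewrite negbK => /eqP/F0.
Qed.

Lemma fourier_op_sum x v : fourier_polynomial x ->
  x ** v = \sum_(h <- support_seq x) x h *: lambda h v.
Proof.
move=> fx; apply/funext => g; rewrite fct_sumE /fourier_op.
by apply: fsbig_support => // h ->; rewrite mul0r.
Qed.

Lemma fourier_op_lambda h y v : lambda h y ** v = lambda h (y ** v).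
Proof.
apply/funext => g; rewrite /fourier_op /lambda.
rewrite (reindex_fsbigT (fun k => h * k)%g).
  by apply: eq_fsbigr => k _; rewrite mulKg invgM mulgA.
by exists (fun k => h^-1 * k)%g => k; rewrite ?mulKg ?mulVKg.
Qed.

Lemma fourier_op_swap x v g :
  (x ** v) g = \sum_(k \in [set: G]) v k * x (g * k^-1)%g.
Proof.
rewrite /fourier_op /lambda (reindex_fsbigT (fun k => g * k^-1)%g).
  by apply: eq_fsbigr => k _; rewrite invgM invgK mulgVK mulrC.
by exists (fun k => k^-1 * g)%g => k; rewrite ?invgM ?invgK ?mulgVK ?mulKg ?mulgK ?mulVKg.
Qed.

Lemma fourier_op_swap_sum x v : fourier_polynomial v ->
  x ** v = \sum_(k <- support_seq v) v k *: rtrans k^-1%g x.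
Proof.
move=> fv; apply/funext => g; rewrite fct_sumE fourier_op_swap.
by apply: fsbig_support => // h ->; rewrite mul0r.
Qed.

Lemma fourier_op_adjoint_sum x v : fourier_polynomial x ->
  adj x ** v = \sum_(h <- support_seq x) (x h)^*%C *: lambda h^-1%g v.
Proof.
move=> fx; apply/funext => g; rewrite fct_sumE /fourier_op /fourier_adjoint.
rewrite (reindex_fsbigT (fun k => k^-1)%g); last by exists (fun k => k^-1)%g; exact: invgK.
rewrite (fsbig_support fx) => [|h xh]; last by rewrite invgK xh conjc0 mul0r.
by apply: eq_bigr => h _; rewrite invgK.
Qed.

Lemma fourier_op_delta x : x ** dlt 1%g = x.
Proof.
apply/funext => g; rewrite fourier_op_swap -(fsbig_widen [set 1%g])//.
  by rewrite fsbig_set1 /dlt eqxx mul1r invg1 mulg1.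
by move=> k [_ /= /eqP k1]; rewrite /dlt (negPf k1) mul0r.
Qed.

Lemma adjK x : adj (adj x) = x.
Proof. by apply/funext => g; rewrite /fourier_adjoint invgK conjcK. Qed.

Lemma fourier_polynomial_adj x : fourier_polynomial x -> fourier_polynomial (adj x).
Proof.
move=> fx; apply: (@sub_finite_set _ _ ((fun g => g^-1)%g @` [set g | x g != 0])).
  move=> g /= xg; exists g^-1%g; last by rewrite invgK.
  by apply: contra_neq xg => xg; rewrite /fourier_adjoint xg conjc0.
exact: finite_image.
Qed.

Lemma fourier_polynomialD x y : fourier_polynomial x -> fourier_polynomial y ->
  fourier_polynomial (x + y).
Proof.
move=> fx fy; apply: (@sub_finite_set _ _ ([set g | x g != 0] `|` [set g | y g != 0])).
  move=> g /=; rewrite fctE; have [->|xg _] := eqVneq (x g) 0; last by left.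
  by rewrite add0r; right.
by rewrite finite_setU.
Qed.

Lemma fourier_polynomialM (f : G -> R[i]) x : fourier_polynomial x ->
  fourier_polynomial (fun g => f g * x g).
Proof.
by apply: sub_finite_set => g /=; apply: contra_neq => ->; rewrite mulr0.
Qed.

Lemma fourier_polynomialZ c x : fourier_polynomial x -> fourier_polynomial (c *: x).
Proof. exact: (@fourier_polynomialM (fun=> c)). Qed.

Lemma fourier_polynomial_lambda h x : fourier_polynomial x ->
  fourier_polynomial (lambda h x).
Proof.
move=> fx; apply: (@sub_finite_set _ _ ((fun g => h * g)%g @` [set g | x g != 0])).
  by move=> g /= xg; exists (h^-1 * g)%g; rewrite // mulVKg.
exact: finite_image.
Qed.

Lemma fourier_polynomial0 : fourier_polynomial (0 : V).
Proof.
rewrite /fourier_polynomial (_ : [set g | _] = classical_sets.set0)//.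
by apply/seteqP; split=> g //=; rewrite eqxx.
Qed.

Lemma fourier_polynomial_sum (I : Type) (r : seq I) (F : I -> V) :
  (forall i, fourier_polynomial (F i)) -> fourier_polynomial (\sum_(i <- r) F i).
Proof.
by move=> fF; elim/big_ind: _ => //; [exact: fourier_polynomial0|exact: fourier_polynomialD].
Qed.

Lemma fourier_polynomial_op x y : fourier_polynomial x -> fourier_polynomial y ->
  fourier_polynomial (x ** y).
Proof.
move=> fx fy; rewrite fourier_op_sum//; apply: fourier_polynomial_sum => h.
exact/fourier_polynomialZ/fourier_polynomial_lambda.
Qed.

Lemma fourier_polynomial_l2 x : fourier_polynomial x -> l2 x.
Proof.
by move=> fx; apply: (l2_fin fx) => g /negP; rewrite negbK => /eqP.
Qed.

Lemma fourier_op_on (A : set G) x v g : (forall h, ~ A h -> x h = 0) ->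
  (x ** v) g = \sum_(h \in A) x h * lambda h v g.
Proof.
move=> xA; symmetry; apply: fsbig_widen => // h [_ /= /xA ->].
by rewrite mul0r.
Qed.

Lemma fourier_opDl x y v : fourier_polynomial x -> fourier_polynomial y ->
  (x + y) ** v = x ** v + y ** v.
Proof.
move=> fx fy; apply/funext => g.
rewrite [RHS](_ : _ = (x ** v) g + (y ** v) g)//.
pose A := [set g | x g != 0] `|` [set g | y g != 0].
have finA : finite_set A by rewrite finite_setU.
have xA h : ~ A h -> x h = 0.
  by move=> /not_orP[/negP + _]; rewrite negbK => /eqP.
have yA h : ~ A h -> y h = 0.
  by move=> /not_orP[_ /negP +]; rewrite negbK => /eqP.
have xyA h : ~ A h -> (x + y) h = 0.
  by move=> Ah; rewrite (_ : (x + y) h = x h + y h)// (xA _ Ah) (yA _ Ah) addr0.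
rewrite !(@fourier_op_on A)//.
by rewrite -fsbig_split//=; apply: eq_fsbigr => h _; rewrite -mulrDl.
Qed.

Lemma fourier_opZl c x v : (c *: x) ** v = c *: (x ** v).
Proof.
apply/funext => g; rewrite [RHS](_ : _ = c * (x ** v) g)// mulr_fsumr.
by apply: eq_fsbigr => h _; rewrite mulrA.
Qed.

Lemma fourier_op0l v : 0 ** v = 0.
Proof. by apply/funext => g; rewrite /fourier_op fsbig1// => h _; rewrite mul0r. Qed.

Lemma fourier_op_suml (I : Type) (r : seq I) (F : I -> V) v :
  (forall i, fourier_polynomial (F i)) ->
  (\sum_(i <- r) F i) ** v = \sum_(i <- r) F i ** v.
Proof.
move=> fF; elim: r => [|i r IH]; first by rewrite !big_nil fourier_op0l.
by rewrite !big_cons fourier_opDl ?IH//; exact: fourier_polynomial_sum.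
Qed.

Lemma fourier_opA x y v : fourier_polynomial x -> fourier_polynomial y ->
  (x ** y) ** v = x ** (y ** v).
Proof.
move=> fx fy; rewrite (fourier_op_sum y fx) fourier_op_suml => [|h]; last first.
  exact/fourier_polynomialZ/fourier_polynomial_lambda.
rewrite (fourier_op_sum (y ** v) fx).
by apply: eq_bigr => h _; rewrite fourier_opZl fourier_op_lambda.
Qed.

Lemma adj_op x y : fourier_polynomial x -> adj (x ** y) = adj y ** adj x.
Proof.
move=> fx; apply/funext => g; rewrite fourier_op_swap /fourier_adjoint.
rewrite (reindex_fsbigT (fun k => k^-1)%g); last by exists (fun k => k^-1)%g; exact: invgK.
rewrite (fsbig_support fx) => [|h xh]; last by rewrite invgK xh conjc0 mul0r.
rewrite fourier_op_sum// fct_sumE raddf_sum.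
apply: eq_bigr => h _.
by rewrite [LHS](conjcM (x h) (y (h^-1 * g^-1)%g)) !invgK /lambda invgM.
Qed.

Lemma lambda_rin h v w : rin (lambda h v) (lambda h w) = rin v w.
Proof.
rewrite !rinE; apply: (real_sum_reindex (e := fun g => h^-1 * g)%g).
rewrite setTT_bijective; exists (fun g => h * g)%g => g; first by rewrite mulVKg.
by rewrite mulKg.
Qed.

Lemma l2_reindex (e : G -> G) v : bijective e -> l2 v -> l2 (fun g => v (e g)).
Proof.
move=> be; rewrite /l2 (reindex_esum [set: G] [set: G] e)//.
by rewrite setTT_bijective.
Qed.

Lemma l2_lambda h v : l2 v -> l2 (lambda h v).
Proof.
apply: l2_reindex; exists (fun g => h * g)%g => g; first by rewrite mulVKg.
by rewrite mulKg.
Qed.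

Lemma l2_rtrans k v : l2 v -> l2 (rtrans k v).
Proof.
apply: l2_reindex; exists (fun g => g * k^-1)%g => g; first by rewrite mulgK.
by rewrite mulgVK.
Qed.

Lemma adj_rin v w : rin (adj v) (adj w) = rin v w.
Proof.
rewrite !rinE -[RHS](real_sum_reindex (e := fun g : G => g^-1%g)); last first.
  by rewrite setTT_bijective; exists (fun g => g^-1)%g; exact: invgK.
by congr real_sum; apply/funext => g; rewrite /fourier_adjoint rdotJ.
Qed.

Lemma lambda_norm h v : l2_norm (lambda h v) = l2_norm v.
Proof. by rewrite !l2_normE lambda_rin. Qed.

Lemma rtrans_bounded k : bounded_by 1 (rtrans k).
Proof.
split=> // [|v lv]; first exact: l2_rtrans.
rewrite mul1r !l2_normE !rinE.
rewrite -(@real_sum_reindex R G G (fun g => g * k)%g (fun g => rdot (v g) (v g)))//.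
rewrite setTT_bijective; exists (fun g => g * k^-1)%g => g; first by rewrite mulgK.
by rewrite mulgVK.
Qed.

Definition l1_norm x : R := \sum_(h <- support_seq x) Num.sqrt (rdot (x h) (x h)).

Lemma l1_norm_ge0 x : 0 <= l1_norm x.
Proof. by apply: sumr_ge0 => h _; exact: sqrtr_ge0. Qed.

Lemma l2_fourier_op x v : fourier_polynomial x -> l2 v -> l2 (x ** v).
Proof.
move=> fx lv; rewrite fourier_op_sum//; apply: l2_sum => h.
exact/l2Z/l2_lambda.
Qed.

Lemma fourier_op_linear x c v w :
  fourier_polynomial x -> x ** (c *: v + w) = c *: (x ** v) + x ** w.
Proof.
move=> fx; rewrite !fourier_op_sum// scaler_sumr -big_split/=.
apply: eq_bigr => h _; apply/funext => g.
rewrite [LHS](_ : _ = x h * (c * v (h^-1 * g)%g + w (h^-1 * g)%g))//.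
rewrite [RHS](_ : _ = c * (x h * v (h^-1 * g)%g) + x h * w (h^-1 * g)%g)//.
by rewrite mulrDr mulrCA.
Qed.

Lemma fourier_op_bounded x : fourier_polynomial x ->
  bounded_by (l1_norm x) (fourier_op x).
Proof.
move=> fx; split=> [v lv|c v w lv lw||v lv].
- exact: l2_fourier_op.
- exact: fourier_op_linear.
- exact: l1_norm_ge0.
have lt h := l2_lambda h lv.
rewrite fourier_op_sum// /l1_norm; elim: (support_seq x) => [|h s IH].
  by rewrite !big_nil l2_norm0 mul0r.
have lZ k : l2 (x k *: lambda k v) by apply: l2Z; exact: lt.
rewrite !big_cons mulrDl; apply: le_trans (l2_normD (lZ h) (l2_sum s lZ)) _.
by apply: lerD IH; rewrite l2_normZ// lambda_norm.
Qed.

Lemma rin_sumr (I : Type) (r : seq I) (F : I -> V) u :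
  l2 u -> (forall i, l2 (F i)) ->
  rin u (\sum_(i <- r) F i) = \sum_(i <- r) rin u (F i).
Proof.
move=> lu lF; elim: r => [|i r IH]; first by rewrite !big_nil rinC rin0l.
by rewrite !big_cons rinDr ?IH//; exact: l2_sum.
Qed.

Lemma fourier_op_adj x u v : fourier_polynomial x -> l2 u -> l2 v ->
  rin (x ** u) v = rin u (adj x ** v).
Proof.
move=> fx lu lv; rewrite rinC fourier_op_sum// fourier_op_adjoint_sum//.
rewrite !rin_sumr//; last first.
- by move=> h; apply/l2Z/l2_lambda.
- by move=> h; apply/l2Z/l2_lambda.
apply: eq_bigr => h _; rewrite rinC rinZl -(lambda_rin h u).
congr rin; apply/funext => g; rewrite [RHS](_ : _ = (x h)^*%C * v (h^-1^-1 * (h^-1 * g))%g)//.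
by rewrite invgK mulVKg.
Qed.

Lemma fourier_op_rtrans x k v : x ** (rtrans k v) = rtrans k (x ** v).
Proof.
by apply/funext => g; rewrite /fourier_op /rtrans /lambda;
  apply: eq_fsbigr => h _; rewrite mulgA.
Qed.

End Convolution.

(** * Existence and uniqueness of the modulus *)

Section Modulus.
Local Open Scope complex_scope.
Context {R : realType} {G : groupType}.
Local Notation V := (G -> R[i]).
Implicit Types (u v w x y : V) (T S : V -> V).

Local Notation "x ** v" := (fourier_op x v) (at level 40, left associativity).
Local Notation adj := fourier_adjoint.

(** The operator [x' x], that is, the square of the modulus. *)
Definition gram x v : V := adj x ** (x ** v).

Lemma gram_bounded x : fourier_polynomial x ->
  bounded_by (l1_norm (adj x) * l1_norm x) (gram x).
Proof.
move=> fx; apply: bounded_comp; last exact: fourier_op_bounded.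
exact/fourier_op_bounded/fourier_polynomial_adj.
Qed.

Lemma gram_rin x u v : fourier_polynomial x -> l2 u -> l2 v ->
  rin (gram x u) v = rin (x ** u) (x ** v).
Proof.
move=> fx lu lv; rewrite /gram fourier_op_adj ?adjK//.
- exact: fourier_polynomial_adj.
- exact: l2_fourier_op.
Qed.

Lemma gram_self_adjoint x : fourier_polynomial x -> self_adjoint (gram x).
Proof.
by move=> fx u v lu lv; rewrite gram_rin// rinC -gram_rin// rinC.
Qed.

Lemma gram_positive x : fourier_polynomial x -> positive_operator (gram x).
Proof.
move=> fx; apply: positive_of_self_adjoint (gram_bounded fx) (gram_self_adjoint fx) _.
by move=> v lv; rewrite gram_rin// rin_ge0.
Qed.

(** The commutation clause serves twice: any other modulus commutes with this one, whence
    uniqueness, and right translations commute with it. *)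
Lemma modulus_exists x : fourier_polynomial x ->
  exists T, is_modulus x T /\
    forall (M : R) (Z : V -> V), bounded_by M Z ->
      commute_on_l2 Z (gram x) -> commute_on_l2 Z T.
Proof.
move=> fx; have bA := gram_bounded fx; have lA := bd_l2 bA.
have lx v : l2 v -> l2 (x ** v) by exact: l2_fourier_op.
(* [c] bounds the squared norm of [x'], so [||x' x v||^2 <= c ||x v||^2], which makes [B] a
   contraction; the 1 keeps [c] positive when [x = 0]. *)
pose c : R := l1_norm (adj x) ^+ 2 + 1.
have c0 : 0 < c by rewrite ltr_wpDl// sqr_ge0.
have ci0 : 0 <= c^-1 by rewrite invr_ge0 ltW.
pose B v : V := v - (c^-1)%:C *: gram x v.
have lB v : l2 v -> l2 (B v) by move=> lv; apply: l2B => //; apply: l2Z; exact: lA.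
have bB : bounded_by 1 B.
  have [_ linB _ _] := bounded_sub (@bounded_id R G) (bounded_scale c^-1 bA).
  split=> // v lv; rewrite mul1r l2_norm_le ?l2_norm_ge0// l2_norm_sqr.
  have lAv := lA _ lv; have lcA := l2Z (c^-1)%:C lAv.
  rewrite rin_sqrB// !rin_realZr// rin_realZl// (rinC v) gram_rin//.
  have : rin (gram x v) (gram x v) <= c * rin (x ** v) (x ** v).
    have bx := fourier_op_bounded (fourier_polynomial_adj fx).
    have := bd_norm bx (lx _ lv); rewrite l2_norm_le; last first.
      by rewrite mulr_ge0 ?l1_norm_ge0 ?l2_norm_ge0.
    rewrite exprMn l2_norm_sqr => /le_trans; apply.
    by rewrite ler_wpM2r ?rin_ge0// lerDl.
  move=> h; have xx := rin_ge0 (x ** v).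
  have h1 : c^-1 * rin (gram x v) (gram x v) <= rin (x ** v) (x ** v).
    by rewrite mulrC ler_pdivrMr// mulrC.
  have h2 := ler_wpM2l ci0 h1.
  have h3 : 0 <= c^-1 * rin (x ** v) (x ** v) by rewrite mulr_ge0.
  lra.
have sB : self_adjoint B.
  move=> u v lu lv; have [lAu lAv] := (lA _ lu, lA _ lv).
  have [lcu lcv] := (l2Z (c^-1)%:C lAu, l2Z (c^-1)%:C lAv).
  by rewrite /B rinBl// rinBr// rin_realZl// rin_realZr// gram_self_adjoint.
pose Y := sqrt_limit B; have bY : bounded_by 1 Y by exact: sqrt_limit_bounded.
have sY : self_adjoint Y by exact: sqrt_limit_self_adjoint.
have lY := bd_l2 bY.
pose r := Num.sqrt c; have r0 : 0 <= r by exact: sqrtr_ge0.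
pose T v : V := r%:C *: (v - Y v).
have bT : exists M, bounded_by M T.
  by have h := bounded_scale r (bounded_sub (@bounded_id R G) bY); eexists; exact: h.
have [M bTM] := bT.
have sT : self_adjoint T.
  move=> u v lu lv; have [lYu lYv] := (lY _ lu, lY _ lv).
  have [ldu ldv] := (l2B lu lYu, l2B lv lYv).
  by rewrite /T rin_realZl// rin_realZr// rinBl// rinBr// sY.
exists T; split; last first.
  move=> N Z bZ cZA v lv; rewrite /T.
  have cZB : commute_on_l2 Z B.
    move=> w lw; rewrite /B (bdB bZ)//; last by apply: l2Z; exact: lA.
    by rewrite (bdZ bZ) ?cZA//; exact: lA.
  have lYv := lY _ lv; rewrite (bdZ bZ) ?(bdB bZ)//; last exact: l2B.
  by rewrite (sqrt_limit_commute bB bZ cZB).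
split; first by apply/bounded_operatorP; exists M.
- apply: positive_of_self_adjoint bTM sT _ => v lv.
  have lYv := lY _ lv; rewrite /T rin_realZl//; last exact: l2B.
  rewrite mulr_ge0// rinBl// subr_ge0.
  apply: le_trans (ler_norm _) _; apply: le_trans (rin_le_norm lYv lv) _.
  rewrite -l2_norm_sqr expr2 ler_wpM2r ?l2_norm_ge0//.
  by have := bd_norm bY lv; rewrite mul1r.
move=> v lv; rewrite -/(gram x v).
have lYv := lY _ lv; have ld := l2B lv lYv; have lYYv := lY _ lYv.
rewrite {1}/T (_ : Y (T v) = r%:C *: (Y v - Y (Y v))); last first.
  by rewrite /T (bdZ bY)// (bdB bY).
rewrite /T -scalerBr scalerA -rmorphM -expr2 sqr_sqrtr ?(ltW c0)//.
(* The fixed point equation solved for [Y^2]; hence [c (1 - Y)^2 = c (1 - B) = x' x]. *)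
have YY : Y (Y v) = Y v + Y v - B v.
  rewrite {2 3}(sqrt_limit_fixpoint bB lv : Y v = _) -scalerDl -rmorphD.
  by rewrite (_ : 2^-1 + 2^-1 = 1 :> R) ?rmorph1 ?scale1r ?[B v + _]addrC ?addrK//; field.
rewrite YY opprB [Y v + Y v - _ - _]addrAC addrK addrA subrK /B opprB addrC subrK.
by rewrite scalerA -rmorphM mulfV ?lt0r_neq0// scale1r.
Qed.

Lemma modulusP x : fourier_polynomial x -> is_modulus x (modulus x).
Proof.
by move=> fx; have [T [mT _]] := modulus_exists fx; exact: (xgetPex _ (ex_intro _ T mT)).
Qed.

(* Any modulus commutes with its square, hence with the one built above. *)
Lemma is_modulus_unique x S T : fourier_polynomial x ->
  is_modulus x S -> is_modulus x T -> forall v, l2 v -> S v = T v.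
Proof.
move=> fx; have [T0 [m0 c0]] := modulus_exists fx.
suff uniq0 U : is_modulus x U -> forall v, l2 v -> U v = T0 v.
  by move=> mS mT v lv; rewrite (uniq0 S mS)// (uniq0 T mT).
case: m0 => /bounded_operatorP[M0 b0] p0 s0.
case=> /bounded_operatorP[M bU] pU sU v lv.
apply: (positive_sqrt_unique bU b0) => // [w lw|w lw].
  apply: (c0 _ _ bU) => // u lu; rewrite /gram -sU// -sU//.
  exact: (bd_l2 bU).
by rewrite sU// s0.
Qed.

(** The modulus built above commutes with whatever commutes with [x' x]; uniqueness transfers this
    to [T]. *)
Lemma is_modulus_rtrans x T k : fourier_polynomial x -> is_modulus x T ->
  commute_on_l2 (rtrans k) T.
Proof.
move=> fx mT; have [T0 [m0 c0]] := modulus_exists fx.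
move=> v lv; have lk := l2_rtrans k lv.
rewrite (is_modulus_unique fx mT m0 lv) (is_modulus_unique fx mT m0 lk).
apply: (c0 _ _ (rtrans_bounded k)) => // w lw.
by rewrite /gram !fourier_op_rtrans.
Qed.

End Modulus.

(** * Coefficients and the trace of the modulus *)

Section CoefficientBound.
Local Open Scope complex_scope.
Context {R : realType} {G : groupType}.
Local Notation V := (G -> R[i]).
Implicit Types (u v w x y : V) (T S Z : V -> V).

Local Notation "x ** v" := (fourier_op x v) (at level 40, left associativity).
Local Notation adj := fourier_adjoint.
Local Notation delta := (dlt 1%g : V).

(** This is [tau (Z y x) = tau (x Z y)]: convolution by [x] on the right is a combination of right
    translations, which pass through [Z] and whose values at 1 are those of the left
    translations. *)
Lemma trace_comm (M : R) Z x y : bounded_by M Z ->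
  (forall k, commute_on_l2 (rtrans k) Z) -> fourier_polynomial x -> l2 y ->
  Z (y ** x) 1%g = (x ** Z y) 1%g.
Proof.
move=> bZ cZ fx ly; rewrite fourier_op_swap_sum// fourier_op_sum//.
rewrite (bd_sum bZ) => [|k]; last by apply: l2Z; exact: l2_rtrans.
rewrite !fct_sumE; apply: eq_bigr => k _.
rewrite (bdZ bZ); last exact: l2_rtrans.
by rewrite -cZ// !fctE /rtrans /lambda mulg1 mul1g.
Qed.

Lemma rin_delta : rin delta delta = 1.
Proof. by rewrite rin_dlt /dlt eqxx. Qed.

Section PositiveOperator.
Variables (M c : R) (T : V -> V).
Hypothesis bT : bounded_by M T.
Hypothesis pT : positive_operator T.
Hypothesis c0 : 0 < c.
Hypothesis Mc : M <= c.
Let sT : self_adjoint T := positive_self_adjoint bT pT.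
Let lT v : l2 v -> l2 (T v). Proof. exact: (bd_l2 bT). Qed.

Lemma form_le v : l2 v -> rin (T v) v <= c * rin v v.
Proof.
move=> lv; apply: le_trans (ler_norm _) _.
apply: le_trans (rin_le_norm (lT lv) lv) _.
rewrite -l2_norm_sqr expr2 mulrA ler_wpM2r ?l2_norm_ge0//.
by apply: le_trans (bd_norm bT lv) _; rewrite ler_wpM2r ?l2_norm_ge0.
Qed.

(** Cauchy-Schwarz for the form at [v] and [T v] gives [|T v|^4 <= <T v, v> <T T v, T v>], and the
    last factor is at most [c |T v|^2]. *)
Lemma image_le_form v : l2 v -> rin (T v) (T v) <= c * rin (T v) v.
Proof.
move=> lv; have lTv := lT lv.
have q0 := positive_rin_ge0 pT lv; have a0 := rin_ge0 (T v).
have := form_CS bT pT lv lTv; have := ler_wpM2l q0 (form_le lTv).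
move=> h1 h2; have := le_trans h2 h1; rewrite expr2 mulrA [_ * c]mulrC.
move: a0; rewrite le_eqVlt => /predU1P[<- _|a0]; last by rewrite ler_pM2r.
by rewrite mulr_ge0// ltW.
Qed.

(** High powers of [1 - T / c] damp the part of a vector on which [T] is not small. *)
Definition damp v : V := v - (c^-1)%:C *: T v.

Lemma damp_bounded : exists N, bounded_by N damp.
Proof.
by have h := bounded_sub (@bounded_id R G) (bounded_scale c^-1 bT); eexists; exact: h.
Qed.

Lemma l2_damp v : l2 v -> l2 (damp v).
Proof. by have [N bN] := damp_bounded; exact: (bd_l2 bN). Qed.

Lemma damp_norm v : l2 v -> rin (damp v) (damp v) <= rin v v - c^-1 * rin (T v) v.
Proof.
move=> lv; have lTv := lT lv; have lcT := l2Z (c^-1)%:C lTv.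
rewrite /damp rin_sqrB// !rin_realZr// rin_realZl// (rinC v).
have h1 : c^-1 * rin (T v) (T v) <= rin (T v) v.
  by rewrite mulrC ler_pdivrMr// mulrC image_le_form.
have ci0 : 0 <= c^-1 by rewrite invr_ge0 ltW.
have h2 := ler_wpM2l ci0 h1.
lra.
Qed.

Lemma damp_form v : l2 v -> rin (T (damp v)) (damp v) <= rin (T v) v.
Proof.
move=> lv; have lTv := lT lv; have lTTv := lT lTv.
have [lcT lcTT] := (l2Z (c^-1)%:C lTv, l2Z (c^-1)%:C lTTv).
rewrite /damp (bdB bT)// (bdZ bT)//; have ld := l2B lv lcT.
rewrite rinBl// !rinBr// !rin_realZl// !rin_realZr// (sT lTv lv).
have h1 : c^-1 * rin (T (T v)) (T v) <= rin (T v) (T v).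
  by rewrite mulrC ler_pdivrMr// mulrC form_le.
have ci0 : 0 <= c^-1 by rewrite invr_ge0 ltW.
have h2 := ler_wpM2l ci0 h1; have h3 := mulr_ge0 ci0 (rin_ge0 (T v)).
lra.
Qed.

Lemma l2_iter_damp n v : l2 v -> l2 (iter n damp v).
Proof. by move=> lv; elim: n => //= n; exact: l2_damp. Qed.

Lemma iter_damp_form n v : l2 v -> rin (T (iter n damp v)) (iter n damp v) <= rin (T v) v.
Proof.
move=> lv; elim: n => //= n; apply: le_trans.
exact/damp_form/l2_iter_damp.
Qed.

(** As long as [|T e|] exceeds [eps], [image_le_form] and [damp_norm] make a step lower [|e|^2] by
    at least [eps^2 / c^2], which cannot go on for ever. *)
Lemma iter_damp_small v eps : l2 v -> 0 < eps ->
  exists n, l2_norm (T (iter n damp v)) <= eps.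
Proof.
move=> lv eps0; apply: contrapT => /forallNP h.
have d0 : 0 < eps ^+ 2 / c ^+ 2 by rewrite divr_gt0// exprn_gt0.
have step n : rin (iter n damp v) (iter n damp v) <= rin v v - n%:R * (eps ^+ 2 / c ^+ 2).
  elim: n => [|n IH]; first by rewrite mul0r subr0.
  have ln := l2_iter_damp n lv.
  have := damp_norm ln => /=; have := image_le_form ln.
  have : eps ^+ 2 <= rin (T (iter n damp v)) (T (iter n damp v)).
    by rewrite -l2_norm_sqr ler_sqr ?nnegrE ?l2_norm_ge0 ?(ltW eps0)// ltW// ltNge; exact/negP.
  move=> h1 h2 h3; apply: le_trans h3 _.
  have h4 : eps ^+ 2 / c ^+ 2 <= c^-1 * rin (T (iter n damp v)) (iter n damp v).
    rewrite ler_pdivrMr ?exprn_gt0//; apply: le_trans (le_trans h1 h2) _.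
    rewrite le_eqVlt; apply/orP; left; apply/eqP.
    by field; rewrite lt0r_neq0.
  rewrite -natr1 mulrDl mul1r; lra.
have [n hn] : exists n : nat, rin v v < n%:R * (eps ^+ 2 / c ^+ 2).
  exists (Num.truncn (rin v v / (eps ^+ 2 / c ^+ 2))).+1.
  by rewrite -ltr_pdivrMr// truncnS_gt.
have := step n; rewrite leNgt => /negP; apply.
by apply: lt_le_trans (rin_ge0 _); rewrite subr_lt0.
Qed.

(** Partial sums of the Neumann series of [T^-1] in powers of [1 - T / c]; they satisfy
    [T r_n = 1 - damp^n]. *)
Fixpoint resolvent n v : V :=
  if n is n'.+1 then resolvent n' v + (c^-1)%:C *: iter n' damp v else 0.

Lemma resolvent_bounded n : exists N, bounded_by N (resolvent n).
Proof.
have [N0 b0] := damp_bounded.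
have bi k : exists N, bounded_by N (iter k damp).
  elim: k => [|k [N bN]]; first by exists 1; exact: bounded_id.
  by exists (N0 * N); exact: bounded_comp b0 bN.
elim: n => [|n [N bN]].
  exists 0; split=> // [v _|d v w _ _|v lv] /=; first exact: l2_0.
    by rewrite scaler0 addr0.
  by rewrite l2_norm0 mul0r.
have [N1 b1] := bi n.
by have h := bounded_add bN (bounded_scale c^-1 b1); eexists; exact: h.
Qed.

Lemma l2_resolvent n v : l2 v -> l2 (resolvent n v).
Proof. by have [N bN] := resolvent_bounded n; exact: (bd_l2 bN). Qed.

Lemma resolvent_commute (N : R) Z n : bounded_by N Z -> commute_on_l2 Z T ->
  commute_on_l2 Z (resolvent n).
Proof.
move=> bZ cZ; have ci k v : l2 v -> Z (iter k damp v) = iter k damp (Z v).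
  move=> lv; elim: k => //= k IH; have lk := l2_iter_damp k lv.
  have lTk := lT lk.
  rewrite {1}/damp (bdB bZ)//; last exact: l2Z.
  by rewrite (bdZ bZ)// cZ// IH.
elim: n => [|n IH] v lv; first by rewrite /= (bd0 bZ).
have [lk lr] := (l2_iter_damp n lv, l2_resolvent n lv).
rewrite /= (bdD bZ)//; last exact: l2Z.
by rewrite IH// (bdZ bZ)// ci.
Qed.

Lemma resolvent_self_adjoint n : self_adjoint (resolvent n).
Proof.
have sd : self_adjoint damp.
  move=> u v lu lv; have [lTu lTv] := (lT lu, lT lv).
  have [lcu lcv] := (l2Z (c^-1)%:C lTu, l2Z (c^-1)%:C lTv).
  by rewrite /damp rinBl// rinBr// rin_realZl// rin_realZr// sT.
have si k u v : l2 u -> l2 v -> rin (iter k damp u) v = rin u (iter k damp v).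
  elim: k u v => // k IH u v lu lv.
  rewrite iterS sd//; last exact: l2_iter_damp.
  by rewrite IH ?iterSr//; exact: l2_damp.
elim: n => [|n IH] u v lu lv; first by rewrite /= rin0l rinC rin0l.
have [lru lrv] := (l2_resolvent n lu, l2_resolvent n lv).
have [lku lkv] := (l2_iter_damp n lu, l2_iter_damp n lv).
have [lcu lcv] := (l2Z (c^-1)%:C lku, l2Z (c^-1)%:C lkv).
by rewrite /= rinDl// rinDr// IH// rin_realZl// rin_realZr// si.
Qed.

Lemma resolventE n v : l2 v -> T (resolvent n v) = v - iter n damp v.
Proof.
move=> lv; elim: n => [|n IH]; first by rewrite /= (bd0 bT) subrr.
have [lk lr] := (l2_iter_damp n lv, l2_resolvent n lv).
rewrite /= (bdD bT)//; last exact: l2Z.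
by rewrite IH (bdZ bT)// /damp opprB addrCA addrC.
Qed.

(** The parallelogram law for the form of [T], with the nonnegative term at [u + v] dropped. *)
Lemma form_sub_le u v : l2 u -> l2 v ->
  rin (T (u - v)) (u - v) <= 2 * rin (T u) u + 2 * rin (T v) v.
Proof.
move=> lu lv; have [lTu lTv] := (lT lu, lT lv).
have := positive_rin_ge0 pT (l2D lu lv).
rewrite (bdD bT)// (bdB bT)//; have [ls ld] := (l2D lu lv, l2B lu lv).
rewrite (rinDl lTu lTv ls) (rinBl lTu lTv ld) !(rinBr lu lv)// !(rinDr lu lv)//.
by rewrite (sT lu lv) (rinC u); lra.
Qed.

End PositiveOperator.

(* Since [x e_n] tends to [0] for [e_n := damp^n delta], only the part
   [delta - e_n = T (r_n delta)] of [delta] matters. There [r_n] plays the role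
   of [T^-1], so [x r_n] that of the partial isometry of the polar decomposition
   of [x]; Cauchy-Schwarz for the form of [T] and the trace property conclude. *)
Lemma Re_coef1_le x T : fourier_polynomial x -> is_modulus x T ->
  complex.Re (x 1%g) <= 2 * rin (T delta) delta.
Proof.
move=> fx mT; have [/bounded_operatorP[M bT] pT TT] := mT.
have sT := positive_self_adjoint bT pT; have lT := bd_l2 bT.
have ld : l2 delta by exact: l2_dlt.
have lx := fourier_polynomial_l2 fx.
have fx' := fourier_polynomial_adj fx; have lx' := fourier_polynomial_l2 fx'.
have lop v : l2 v -> l2 (x ** v) by exact: l2_fourier_op.
pose c := M + 1; have c0 : 0 < c by rewrite ltr_wpDl// (bd_ge0 bT).
have Mc : M <= c by rewrite lerDl.
have q0 := positive_rin_ge0 pT ld.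
apply/ler_addgt0Pl => eps eps0.
have [n en] := iter_damp_small bT pT c0 Mc ld eps0.
pose e : V := iter n (damp c T) delta; pose r := resolvent c T n.
have le : l2 e by exact: l2_iter_damp bT _ _ ld.
have [N br] := resolvent_bounded c bT n; have lr := bd_l2 br.
have sr : self_adjoint r by exact: resolvent_self_adjoint bT pT n.
have crT : commute_on_l2 T r by apply: (resolvent_commute c bT n bT).
pose p := T (r delta).
have lp : l2 p by apply: lT; exact: lr.
have pE : p = delta - e by exact: (resolventE c bT n ld).
have -> : complex.Re (x 1%g) = rin (x ** e) delta + rin (x ** p) delta.
  rewrite -rinDl//; do ?exact: lop.
  rewrite -(bdD (fourier_op_bounded fx))// pE addrC subrK fourier_op_delta.
  by rewrite rin_dlt.
apply: lerD.
  (* As [T^2 = x' x], the vectors [x e] and [T e] have the same norm. *)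
  apply: le_trans (ler_norm _) _; apply: le_trans (rin_le_norm (lop _ le) ld) _.
  rewrite [X in _ * X]l2_normE rin_delta sqrtr1 mulr1; apply: le_trans en.
  rewrite l2_norm_le ?l2_norm_ge0// l2_norm_sqr -gram_rin// /gram -TT//.
  by rewrite sT//; exact: lT.
have lrx := lr _ lx'; have lTd := lT _ ld; have lrd := lr _ ld.
have -> : rin (x ** p) delta = rin (T delta) (r (adj x)).
  by rewrite fourier_op_adj// fourier_op_delta /p crT// sr.
(* With [Z = r T r], the left side is [tau (x Z x')], which the trace property turns into
   [tau (Z x' x) = tau (Z T^2)]; moving [r] and [T] across the pairing gives the right side. *)
have trace : rin (T (r (adj x))) (r (adj x)) = rin (T p) p.
  pose Z v := r (T (r v)).
  have bZ : bounded_by (N * (M * N)) Z by exact: bounded_comp br (bounded_comp bT br).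
  have cZ k : commute_on_l2 (rtrans k) Z.
    have cT := is_modulus_rtrans k fx mT.
    have cr : commute_on_l2 (rtrans k) r.
      by apply: (resolvent_commute c bT n (rtrans_bounded k)).
    move=> v lv; have lrv := lr _ lv; have lTrv := lT _ lrv.
    by rewrite /Z cr// cT// cr.
  have lTrx := lT _ lrx.
  rewrite -sr// -/(Z (adj x)) -{2}(fourier_op_delta (adj x)).
  have lZx := bd_l2 bZ lx'.
  rewrite -fourier_op_adj// rin_dlt -(trace_comm bZ cZ fx lx') -rin_dlt.
  rewrite -{2}(fourier_op_delta x) -/(gram x delta) /gram -TT//.
  have lTTd := lT _ lTd; have lrTTd := lr _ lTTd; have lTrTTd := lT _ lrTTd.
  rewrite /Z sr// sT// -crT//; have lrTd := lr _ lTd.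
  by rewrite -crT.
(* The 4 is the 2 + 2 of [form_sub_le], as the form at [e] is at most that at [delta]; its root is
   the 2 of the conclusion. *)
have q4 : rin (T p) p <= 4 * rin (T delta) delta.
  rewrite pE; apply: le_trans (form_sub_le bT pT ld le) _.
  have := iter_damp_form bT pT c0 Mc n ld; rewrite -/e; lra.
have := form_CS bT pT ld lrx; rewrite trace => h.
have h2 : rin (T delta) (r (adj x)) ^+ 2 <= (2 * rin (T delta) delta) ^+ 2.
  by apply: le_trans h _; have := ler_wpM2l q0 q4; rewrite expr2; lra.
have q20 : 0 <= 2 * rin (T delta) delta by rewrite mulr_ge0.
by apply: le_trans (ler_norm _) _; rewrite -ler_sqr ?nnegrE// real_normK ?num_real.
Qed.

End CoefficientBound.

(** * The norms for p = 1, 2, 4 and the finiteness of kappa *)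

Section LpNorms.
Local Open Scope complex_scope.
Context {R : realType} {G : groupType}.
Local Notation V := (G -> R[i]).
Implicit Types (u v w x y : V) (T S Z : V -> V).

Local Notation "x ** v" := (fourier_op x v) (at level 40, left associativity).
Local Notation adj := fourier_adjoint.
Local Notation delta := (dlt 1%g : V).

Lemma l2_gram_delta x : fourier_polynomial x -> l2 (gram x delta).
Proof. by move=> fx; apply: bd_l2 (gram_bounded fx) _ _; exact: l2_dlt. Qed.

Lemma gram_delta x : gram x delta = adj x ** x.
Proof. by rewrite /gram fourier_op_delta. Qed.

Lemma Lp_norm1E x T : fourier_polynomial x -> is_modulus x T ->
  Lp_norm 1 x = rin (T delta) delta.
Proof.
move=> fx mT; have ld : l2 delta by exact: l2_dlt.
rewrite /Lp_norm /tau /= -[delta1]/(delta).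
rewrite (is_modulus_unique fx (modulusP fx) mT ld) -rin_dlt invr1 powRr1//.
by case: mT => _ pT _; exact: positive_rin_ge0.
Qed.

Lemma Lp_norm2E x : fourier_polynomial x -> Lp_norm 2 x = l2_norm x.
Proof.
move=> fx; have ld : l2 delta by exact: l2_dlt.
case: (modulusP fx) => _ _ sM.
rewrite /Lp_norm /tau /= -[delta1]/(delta) sM// -rin_dlt -/(gram x delta).
by rewrite gram_rin// fourier_op_delta powR12_sqrt ?rin_ge0.
Qed.

(** [tau (|x|^4) = <(x' x)^2 delta, delta> = ||x' x||_2^2]. *)
Lemma Lp_norm4E x : fourier_polynomial x ->
  Lp_norm 4 x ^+ 2 = l2_norm (adj x ** x).
Proof.
move=> fx; have ld : l2 delta by exact: l2_dlt.
case: (modulusP fx) => /bounded_operatorP[M bM] _ sM.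
rewrite /Lp_norm /tau /= -[delta1]/(delta) (sM delta)// -/(gram x delta).
have lg := l2_gram_delta fx.
rewrite sM// -/(gram x (gram x delta)) -rin_dlt gram_self_adjoint// gram_delta.
rewrite -l2_norm_sqr -powR_mulrn ?powR_ge0// -powRrM -(powR_mulrn 2) ?l2_norm_ge0//.
by rewrite -powRrM (_ : 2 * (4^-1 * 2) = 1) ?powRr1 ?l2_norm_ge0//; field.
Qed.

Lemma gram_lambda h x v : gram (lambda h x) v = gram x v.
Proof.
apply/funext => g; rewrite /gram fourier_op_lambda [LHS]/fourier_op.
rewrite (reindex_fsbigT (fun k => k * h^-1)%g); last first.
  by exists (fun k => k * h)%g => k; rewrite ?mulgVK ?mulgK.
apply: eq_fsbigr => k _; rewrite /fourier_adjoint /lambda.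
by rewrite !invgM !invgK mulKg -mulgA mulKg.
Qed.

Lemma gramZ c x v : fourier_polynomial x -> l2 v -> rdot c c = 1 ->
  gram (c *: x) v = gram x v.
Proof.
move=> fx lv c1; have fx' := fourier_polynomial_adj fx.
have -> : gram (c *: x) v = (c^*%C *: adj x) ** (c *: (x ** v)).
  rewrite /gram fourier_opZl (_ : adj (c *: x) = c^*%C *: adj x)//.
  by apply/funext => g; exact: conjcM.
rewrite fourier_opZl (bdZ (fourier_op_bounded fx')); last exact: l2_fourier_op.
rewrite scalerA (_ : c^*%C * c = 1) ?scale1r//.
move: c1; rewrite rdotE; case: c => a b /= c1; apply/eqP; rewrite eq_complex /=.
by apply/andP; split; apply/eqP; rewrite -?c1; ring.
Qed.

(** The coefficient at [g] is the one at 1 of [lambda g^-1 x], and neither this translation nor the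
    unimodular [c] changes the modulus. *)
Lemma Re_coef_le c g x T : fourier_polynomial x -> is_modulus x T -> rdot c c = 1 ->
  complex.Re (c * x g) <= 2 * rin (T delta) delta.
Proof.
move=> fx [bT pT sT] c1.
have fl := fourier_polynomial_lambda g^-1%g fx.
have fcl := fourier_polynomialZ c fl.
have -> : c * x g = (c *: lambda g^-1%g x) 1%g.
  by rewrite [RHS](_ : _ = c * x (g^-1^-1 * 1)%g)// invgK mulg1.
apply: Re_coef1_le => //; split=> // v lv.
by rewrite -/(gram _ v) gramZ// gram_lambda sT.
Qed.

Lemma rdot_coef_le g x : fourier_polynomial x ->
  rdot (x g) (x g) <= 8 * Lp_norm 1 x ^+ 2.
Proof.
move=> fx; have mT := modulusP fx; rewrite (Lp_norm1E fx mT).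
have h c := Re_coef_le g (c := c) fx mT.
have one (a b : R) : a ^+ 2 + b ^+ 2 = 1 -> rdot (a +i* b) (a +i* b) = 1.
  by rewrite rdotE /= -!expr2.
(* The four units bound the real and imaginary parts in absolute value by twice the trace; adding
   the two squares gives the 8. *)
have h1 := h (1 +i* 0) (one _ _ _); have h2 := h (-1 +i* 0) (one _ _ _).
have h3 := h (0 +i* 1) (one _ _ _); have h4 := h (0 +i* -1) (one _ _ _).
rewrite rdotE -!expr2; move: h1 h2 h3 h4; case: (x g) => a b /=.
set q := rin _ _; rewrite !(mul0r, mul1r, mulN1r, subr0, sub0r, opprK, sqrrN, expr1n, expr0n, addr0, add0r).
move=> /(_ erefl) h1 /(_ erefl) h2 /(_ erefl) h3 /(_ erefl) h4.
have q0 : 0 <= 2 * q by lra.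
have sq z : z <= 2 * q -> - z <= 2 * q -> z ^+ 2 <= (2 * q) ^+ 2.
  move=> z1 z2; rewrite -real_normK ?num_real// ler_sqr ?nnegrE// ler_norml.
  by apply/andP; split; lra.
have ha := sq a h1 h2; have hb := sq b h4 h3.
by move: ha hb; rewrite exprMn; lra.
Qed.

Lemma fourier_polynomial_proj (E : set G) x :
  fourier_polynomial x -> fourier_polynomial (fourier_proj E x).
Proof.
by apply: sub_finite_set => g /=; apply: contra_neq; rewrite /fourier_proj => ->; case: ifP.
Qed.

(** [fine] sends an infinite supremum to 0, so finiteness has to come before the bound; over a
    finite [E] the coefficient estimate provides it. *)
Lemma proj_norm1_le (E : set G) x : finite_set E -> fourier_polynomial x ->
  Lp_norm 1 x <= 1 ->
  l2_norm (fourier_proj E x) <= fine (proj_norm1 (R := R) 2 E).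
Proof.
move=> finE fx x1.
pose K : R := \sum_(g \in E) (8 : R).
have bnd y : fourier_polynomial y -> Lp_norm 1 y <= 1 ->
    l2_norm (fourier_proj E y) <= Num.sqrt K.
  move=> fy y1; rewrite l2_normE ler_sqrt ?rin_ge0//; last first.
    by apply: fsumr_ge0 => // g _.
  rewrite rin_fourier_proj// /K !fsbig_finite//=; apply: ler_sum => g _.
  apply: le_trans (rdot_coef_le g fy) _.
  rewrite -[leRHS]mulr1 ler_wpM2l// expr_le1//.
  by rewrite /Lp_norm powR_ge0.
have le_K : (proj_norm1 (R := R) 2 E <= (Num.sqrt K)%:E)%E.
  apply: ge_ereal_sup => _ [y [fy y1] <-]; rewrite lee_fin Lp_norm2E ?bnd//.
  exact: fourier_polynomial_proj.
have le_x : ((l2_norm (fourier_proj E x))%:E <= proj_norm1 (R := R) 2 E)%E.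
  apply: ereal_sup_ubound; exists x => //.
  by rewrite Lp_norm2E//; exact: fourier_polynomial_proj.
rewrite -lee_fin fineK// fin_numElt; apply/andP; split.
  by apply: lt_le_trans le_x; rewrite ltNyr.
by apply: le_lt_trans le_K _; rewrite ltry.
Qed.

Lemma proj_norm1_ge0 (E : set G) : finite_set E -> 0 <= fine (proj_norm1 (R := R) 2 E).
Proof.
move=> finE; apply: le_trans (proj_norm1_le (x := 0) finE (@fourier_polynomial0 R G) _).
  exact: l2_norm_ge0.
have m0 : is_modulus (0 : V) (fourier_op 0).
  split; first by apply/bounded_operatorP; eexists; exact: fourier_op_bounded fourier_polynomial0.
    move=> v lv; rewrite fourier_op0l l2_innerE !rin0l lecE /= eqxx lexx//.
  move=> v lv; rewrite !fourier_op0l; symmetry.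
  by apply: (bd0 (fourier_op_bounded (fourier_polynomial_adj fourier_polynomial0))).
by rewrite (Lp_norm1E fourier_polynomial0 m0) fourier_op0l rin0l ler01.
Qed.

(** [y y'] is positive, hence its own modulus by uniqueness, and its trace is
    [||y'||_2^2 = ||y||_2^2]. *)
Lemma Lp_norm1_square y : fourier_polynomial y ->
  Lp_norm 1 (y ** adj y) = rin y y.
Proof.
move=> fy; have fy' := fourier_polynomial_adj fy.
have fw := fourier_polynomial_op fy fy'.
have wE v : (y ** adj y) ** v = gram (adj y) v by rewrite fourier_opA// /gram adjK.
have mw : is_modulus (y ** adj y) (fourier_op (y ** adj y)).
  split; first by apply/bounded_operatorP; eexists; exact: fourier_op_bounded fw.
    by move=> v lv; rewrite wE; exact: gram_positive.
  by move=> v lv; rewrite adj_op// adjK.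
by rewrite (Lp_norm1E fw mw) wE gram_rin ?fourier_op_delta ?adj_rin//; exact: l2_dlt.
Qed.

(** [kappa] tests the unit ball of L^1. It is reached by scaling [y] to an l2 unit vector [z]: then
    [z z'] has L^1 norm 1 by [Lp_norm1_square]. *)
Lemma l2_norm_proj_square (E : set G) y : finite_set E -> fourier_polynomial y ->
  l2_norm (fourier_proj E (y ** adj y)) <= fine (proj_norm1 (R := R) 2 E) * rin y y.
Proof.
move=> finE fy; have ly := fourier_polynomial_l2 fy.
have fy' := fourier_polynomial_adj fy.
have [y0|yN0] := eqVneq (rin y y) 0.
  rewrite (rin_eq0 ly y0) fourier_op0l.
  rewrite (_ : fourier_proj E 0 = 0) ?l2_norm0 ?rin0l ?mulr0//.
  by apply/funext => g; rewrite /fourier_proj; case: ifP.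
have y0 : 0 < rin y y by rewrite lt0r yN0 rin_ge0.
pose s := Num.sqrt (rin y y)^-1; have s2 : s ^+ 2 = (rin y y)^-1.
  by rewrite sqr_sqrtr// invr_ge0 ltW.
pose z : V := s%:C *: y; have fz : fourier_polynomial z by exact: fourier_polynomialZ.
have lz := fourier_polynomial_l2 fz.
have z1 : rin z z = 1 by rewrite /z rin_realZl// rin_realZr// mulrA -expr2 s2 mulVf.
have := proj_norm1_le finE (fourier_polynomial_op fz (fourier_polynomial_adj fz)).
rewrite Lp_norm1_square// z1 => /(_ (lexx _)).
have zz : z ** adj z = (s ^+ 2)%:C *: (y ** adj y).
  rewrite fourier_opZl.
  have -> : adj z = s%:C *: adj y.
    by apply/funext => g; rewrite [LHS](conjcM s%:C (y g^-1%g)) conjc_real.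
  rewrite (bdZ (fourier_op_bounded fy)); last exact: fourier_polynomial_l2.
  by rewrite scalerA -rmorphM -expr2.
have -> : fourier_proj E (z ** adj z) = (s ^+ 2)%:C *: fourier_proj E (y ** adj y).
  rewrite zz; apply/funext => g; rewrite /fourier_proj.
  rewrite [RHS](_ : _ = (s ^+ 2)%:C * fourier_proj E (y ** adj y) g)// /fourier_proj.
  by case: ifP => // _; rewrite mulr0.
have lw : l2 (fourier_proj E (y ** adj y)) by exact: l2_fourier_proj_fin.
by rewrite l2_norm_realZ// s2 ger0_norm ?invr_ge0 ?(ltW y0)// mulrC ler_pdivrMr.
Qed.

End LpNorms.

(** * Cotlar's inequality *)

Section Cotlar.
Local Open Scope complex_scope.
Context {R : realType} {G : groupType}.
Local Notation V := (G -> R[i]).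
Implicit Types (u v w x y : V).

Local Notation "x ** v" := (fourier_op x v) (at level 40, left associativity).
Local Notation adj := fourier_adjoint.

Lemma rin_right_adj u v y :
  fourier_polynomial u -> fourier_polynomial v -> fourier_polynomial y ->
  rin (u ** adj y) v = rin u (v ** y).
Proof.
move=> fu fv fy; have fu' := fourier_polynomial_adj fu.
have fv' := fourier_polynomial_adj fv.
rewrite -adj_rin adj_op// adjK fourier_op_adj//; do ?exact: fourier_polynomial_l2.
by rewrite -adj_op// adj_rin.
Qed.

(** Cyclicity of the trace: [tau (y x' x y') = tau (x' x y' y)]. *)
Lemma rin_cross_square x y : fourier_polynomial x -> fourier_polynomial y ->
  rin (x ** adj y) (x ** adj y) = rin (adj x ** x) (adj y ** y).
Proof.
move=> fx fy; have fx' := fourier_polynomial_adj fx.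
have fy' := fourier_polynomial_adj fy; have ly' := fourier_polynomial_l2 fy'.
rewrite -gram_rin// /gram -fourier_opA// rin_right_adj//.
exact: fourier_polynomial_op.
Qed.

(** An instance of the Hölder inequality, obtained from Cauchy-Schwarz for [x' x] and [y' y]. *)
Lemma l2_norm_cross x y : fourier_polynomial x -> fourier_polynomial y ->
  l2_norm (x ** adj y) <= Lp_norm 4 x * Lp_norm 4 y.
Proof.
move=> fx fy; have fx' := fourier_polynomial_adj fx.
have fy' := fourier_polynomial_adj fy.
rewrite l2_norm_le; last by rewrite mulr_ge0// powR_ge0.
rewrite rin_cross_square// exprMn !Lp_norm4E//.
apply: le_trans (ler_norm _) _; apply: rin_le_norm;
  exact/fourier_polynomial_l2/fourier_polynomial_op.
Qed.

Lemma l2_norm_square x : fourier_polynomial x ->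
  l2_norm (x ** adj x) = Lp_norm 4 x ^+ 2.
Proof.
by move=> fx; rewrite Lp_norm4E// !l2_normE rin_cross_square.
Qed.

(** Cauchy-Schwarz for [x' x delta] against the unit vector [delta]. *)
Lemma rin_le_Lp_norm4 x : fourier_polynomial x -> rin x x <= Lp_norm 4 x ^+ 2.
Proof.
move=> fx; have ld : l2 (dlt 1%g : V) by exact: l2_dlt.
have lg := l2_gram_delta fx.
rewrite Lp_norm4E// -{1 2}(fourier_op_delta x) -gram_rin//.
apply: le_trans (ler_norm _) _; apply: le_trans (rin_le_norm lg ld) _.
by rewrite [X in _ * X]l2_normE rin_delta sqrtr1 mulr1 gram_delta.
Qed.

(** The hypothesis amounts to [(b - a)^2 <= (2 + k) a^2]. *)
Lemma square_root_bound (k a b : R) : 0 <= k -> 0 <= a -> 0 <= b ->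
  b ^+ 2 <= k * a ^+ 2 + 2 * (a * b) + a ^+ 2 -> b <= (1 + Num.sqrt (2 + k)) * a.
Proof.
move=> k0 a0 b0 h; have s0 : 0 <= Num.sqrt (2 + k) * a by rewrite mulr_ge0 ?sqrtr_ge0.
have hs : `|b - a| ^+ 2 <= (Num.sqrt (2 + k) * a) ^+ 2.
  rewrite real_normK ?num_real// exprMn sqr_sqrtr ?addr_ge0//.
  by move: h; rewrite !expr2; lra.
rewrite ler_sqr ?nnegrE// in hs.
have := le_trans (ler_norm _) hs; rewrite mulrDl mul1r; lra.
Qed.

(* The hypothesis says that [(m g - F k) * (m h - F k^-1)^* = 0] whenever
   [k = g h^-1] lies outside [E]; summing over such [g], [h] gives Cotlar's
   identity for the coefficients of [y y^*] outside [E]. *)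
Lemma cotlar_bound (E : set G) x (m F : V) : finite_set E -> fourier_polynomial x ->
  (forall g, rdot (m g) (m g) <= 1) -> (forall g, rdot (F g) (F g) <= 1) ->
  (forall g h, x g != 0 -> x h != 0 -> ~ E (g * h^-1)%g ->
     F (g * h^-1)%g = m g \/ F (h * g^-1)%g = m h) ->
  Lp_norm 4 (fun g => m g * x g) <=
    (1 + Num.sqrt (2 + fine (proj_norm1 (R := R) 2 E))) * Lp_norm 4 x.
Proof.
move=> finE fx m1 F1 mF; set y : V := fun g => m g * x g.
have fy : fourier_polynomial y by exact: fourier_polynomialM.
have [fx' fy'] := (fourier_polynomial_adj fx, fourier_polynomial_adj fy).
have lop u v : fourier_polynomial u -> fourier_polynomial v -> l2 (u ** v).
  by move=> fu fv; exact/fourier_polynomial_l2/fourier_polynomial_op.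
pose F' : V := fun k => (F k^-1%g)^*%C.
have F'1 k : rdot (F' k) (F' k) <= 1 by rewrite rdotJ.
have le1M (a b : R[i]) : rdot a a <= 1 -> rdot (a * b) (a * b) <= rdot b b.
  by move=> a1; rewrite rdotMM ler_piMl// rdot_ge0.
(* The three terms of Cotlar's identity, cut off to the complement of [E]; the symbols have modulus
   at most 1, so only the norms of the products remain. *)
pose u1 : V := fun k => F k * fourier_proj (~` E) (x ** adj y) k.
pose u2 : V := fun k => F' k * fourier_proj (~` E) (y ** adj x) k.
pose u3 : V := fun k => F k * (F' k * fourier_proj (~` E) (x ** adj x) k).
have mul_proj (H : V) v : (forall k, rdot (H k) (H k) <= 1) -> forall k,
    rdot (H k * fourier_proj (~` E) v k) (H k * fourier_proj (~` E) v k)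
    <= rdot (v k) (v k).
  by move=> H1 k; apply: le_trans (fourier_proj_le (~` E) v k); exact: le1M.
have b1 k : rdot (u1 k) (u1 k) <= rdot ((x ** adj y) k) ((x ** adj y) k).
  exact: mul_proj.
have b2 k : rdot (u2 k) (u2 k) <= rdot ((y ** adj x) k) ((y ** adj x) k).
  exact: mul_proj.
have b3 k : rdot (u3 k) (u3 k) <= rdot ((x ** adj x) k) ((x ** adj x) k).
  apply: le_trans (mul_proj F' (x ** adj x) F'1 k); exact: le1M.
have [l1 l2' l3] : [/\ l2 u1, l2 u2 & l2 u3].
  by split; [apply: l2_le b1 _|apply: l2_le b2 _|apply: l2_le b3 _]; exact: lop.
have cross a b k : fourier_polynomial a ->
    (a ** adj b) k = \sum_(h \in [set: G]) a h * (b (k^-1 * h)%g)^*%C.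
  move=> fa; apply: eq_fsbigr => h _.
  by rewrite /lambda /fourier_adjoint invgM invgK.
have identity : y ** adj y = fourier_proj E (y ** adj y) + (u1 + u2 - u3).
  apply/funext => k.
  rewrite [RHS](_ : _ = fourier_proj E (y ** adj y) k + (u1 k + u2 k - u3 k))//.
  rewrite /u1 /u2 /u3 /fourier_proj classical_sets.in_setC; case: (boolP (k \in E)) => kE /=.
    by rewrite !mulr0 subr0 !addr0.
  rewrite add0r !cross//.
  (* [y] vanishes where [x] does, so all four sums run over the support of [x] and can be compared
     term by term. *)
  rewrite !(fsbig_support fx); do ?[by move=> g; rewrite /y => ->; rewrite ?mulr0 mul0r].
  rewrite !mulr_sumr -big_split/= -sumrB; apply: eq_bigr => g _.
  set h := (k^-1 * g)%g.
  have [xg|xg] := eqVneq (x g) 0; first by rewrite /y xg !(mulr0, mul0r) subr0 addr0.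
  have [xh|xh] := eqVneq (x h) 0.
    by rewrite /y xh !(mulr0, mul0r, conjc0) subr0 addr0.
  have kE' : ~ E (g * h^-1)%g.
    by rewrite /h invgM invgK mulVKg; move: kE; rewrite notin_setE.
  have := mF g h xg xh kE'.
  rewrite {1}/h invgM invgK mulVKg {1}/h mulgK /F' /y !conjcM.
  by case=> ->; ring.
have [k0 a0 b0] : [/\ 0 <= fine (proj_norm1 (R := R) 2 E), 0 <= Lp_norm 4 x &
    0 <= Lp_norm 4 y] by split; rewrite ?proj_norm1_ge0 ?powR_ge0.
apply: square_root_bound => //; rewrite -[in leLHS](l2_norm_square fy) identity.
have lp : l2 (fourier_proj E (y ** adj y)) by exact: l2_fourier_proj_fin.
have l12 := l2D l1 l2'.
(* The part in [E] gives [kappa a^2], as [||y||_2 <= ||x||_2 <= a]; [u1] and [u2] give [2 a b], and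
   [u3] gives [a^2]. *)
apply: le_trans (l2_normD lp (l2B l12 l3)) _; rewrite -[leRHS]addrA; apply: lerD.
  apply: le_trans (l2_norm_proj_square finE fy) _; rewrite ler_wpM2l//.
  apply: le_trans (rin_le_Lp_norm4 fx); apply: le_rin; last exact: fourier_polynomial_l2.
  by move=> g; exact: le1M.
apply: le_trans (l2_normB l12 l3) _; apply: lerD.
  apply: le_trans (l2_normD l1 l2') _.
  have h1 := le_trans (le_l2_norm b1 (lop _ _ fx fy')) (l2_norm_cross fx fy).
  have h2 := le_trans (le_l2_norm b2 (lop _ _ fy fx')) (l2_norm_cross fy fx).
  have comm2 (p q : R) : p * q + q * p = 2 * (p * q) by ring.
  by rewrite -comm2; exact: lerD h1 h2.
by rewrite -l2_norm_square//; apply: le_l2_norm b3 (lop _ _ fx fx').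
Qed.

End Cotlar.

(** * Multipliers of pairwise disjoint sets *)

Section DisjointMultiplier.
Context {R : realType} {G : groupType} {I : choiceType}.
Variables (L : I -> set G) (eps : I -> R[i]).

Lemma fourier_multiplier_at (x : G -> R[i]) i g :
  (forall j, L j g -> j = i) -> L i g ->
  fourier_multiplier L eps x g = eps i * x g.
Proof.
move=> Li gi; rewrite /fourier_multiplier -(fsbig_widen [set i])//.
  by rewrite fsbig_set1 /fourier_proj mem_set.
move=> j [_ /= ji]; rewrite /fourier_proj memNset ?mulr0//.
by move=> /Li.
Qed.

(** The symbol is what the formula yields on the constant function 1, although that is in general no
    Fourier polynomial. *)
Lemma fourier_multiplier_symbol (x : G -> R[i]) g :
  fourier_multiplier L eps x g = fourier_multiplier L eps (fun=> 1) g * x g.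
Proof.
rewrite /fourier_multiplier mulr_fsuml; apply: eq_fsbigr => i _.
by rewrite /fourier_proj; case: ifP; rewrite ?mulr1 // mulr0 mul0r.
Qed.

Lemma fourier_multiplier_le1 g :
  (forall i j, L i g -> L j g -> i = j) -> (forall i, `|eps i| <= 1) ->
  rdot (fourier_multiplier L eps (fun=> 1) g) (fourier_multiplier L eps (fun=> 1) g) <= 1.
Proof.
move=> Ldisj eps1.
have [[i gi]|nL] := pselect (exists i, L i g).
  rewrite (fourier_multiplier_at _ (i := i))// ?mulr1 => [|j gj]; last exact: Ldisj.
  have := eps1 i; rewrite -[X in _ <= X](normr1 (complex R)) normc_leP.
  by rewrite [X in _ <= X]rdotE /= mulr1 mulr0 addr0.
rewrite /fourier_multiplier fsbig1 => [|i _]; first by rewrite /rdot mul0r ler01.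
by rewrite /fourier_proj memNset ?mulr0// => gi; apply: nL; exists i.
Qed.

End DisjointMultiplier.

(** [C4] is chosen before the group, the space and the action, which expresses that the constant
    depends on [kappa] alone. *)
Theorem corollary3p3 (R : realType) :
  exists C4 : \bar R -> R,
  forall (G : groupType) (X : metricType R) (act : G -> X -> X) (o : X)
         (delta m : R) (I : choiceType) (A : I -> set X),
    isometric_action act ->
    geodesic_space X ->
    hyperbolic X delta ->
    0 < m ->
    (forall i, A i `<=` sphere o m) ->
    (forall i j, i != j -> ((4 * delta)%:E <= set_dist (A i) (A j))%E) ->
    finite_set (E_lt act o (2 * m + 2 * delta)) ->
    forall (x : G -> R[i]) (eps : I -> R[i]),
      fourier_polynomial x ->
      [set g | x g != 0] `<=` \bigcup_(i in [set: I]) L_exists act o (A i) ->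
      finite_set [set i | eps i != 0] ->
      (forall i, `|eps i| <= 1) ->
      Lp_norm 4 (H_exists act o A eps x)
        = Lp_norm 4 (H_forall act o delta A eps x) /\
      Lp_norm 4 (H_exists act o A eps x)
        <= C4 (kappa act o 2 (2 * m + 2 * delta)) * Lp_norm 4 x.
Proof.
exists (fun k => 1 + Num.sqrt (2 + fine k)).
move=> G X act o delta m I A iso geo hyp _ Am Afar finE x eps fx xA _ eps1.
pose L i := L_forall act o delta (A i).
have Ldisj g i j : L i g -> L j g -> i = j.
  move=> gi gj; have [//|ij] := eqVneq i j; exfalso.
  exact: (L_forall_disjoint geo (Am i) (Am j) (Afar i j ij) gi gj).
have sub i g : L_exists act o (A i) g -> L i g by exact: L_exists_sub_forall.
pose F : G -> R[i] := fourier_multiplier L eps (fun=> 1).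
have FE i g : L i g -> F g = eps i.
  move=> gi; rewrite /F (fourier_multiplier_at _ _ (i := i))// ?mulr1// => j gj.
  exact: Ldisj gj gi.
have forallE : H_forall act o delta A eps x = fun g => F g * x g.
  by apply/funext => g; exact: fourier_multiplier_symbol.
(* Off the support of [x] both sides vanish; on it [g] lies in some [L_exists], hence in exactly one
   [L i] and in no other [L_exists]. *)
have existsE : H_exists act o A eps x = fun g => F g * x g.
  apply/funext => g; have [xg|xg] := eqVneq (x g) 0.
    rewrite xg mulr0 /H_exists /fourier_multiplier fsbig1// => i _.
    by rewrite /fourier_proj xg; case: ifP; rewrite mulr0.
  have [i _ gi] := xA g xg; rewrite (FE i g (sub _ _ gi)).
  apply: fourier_multiplier_at => // j gj.
  by apply: (Ldisj g); exact: sub.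
rewrite forallE existsE; split=> //.
have F1 g : rdot (F g) (F g) <= 1.
  by apply: fourier_multiplier_le1 => // i j; exact: Ldisj.
(* [F] plays both roles: it equals [eps i] on all of [L i], so [g h^-1] starting like [g] means that
   [F] agrees at both. *)
apply: (cotlar_bound finE fx F1 F1) => g h xg xh nE.
have [i _ gi] := xA g xg; have [j _ hj] := xA h xh.
have [li|lj] := product_starts_like_factor iso geo hyp (Am i) (Am j) gi hj nE.
  by left; rewrite (FE _ _ li) (FE _ _ (sub _ _ gi)).
by right; rewrite (FE _ _ lj) (FE _ _ (sub _ _ hj)).
Qed.
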